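(* Let $p,q\in\mathbb{N}$ be positive integers with greatest common divisor $1$, and suppose that $\theta\in(0,\frac{\pi}{3})$ satisfies $\tan\theta=\frac{\sqrt{3}\,p}{2q+p}$. Let $\alpha(\theta)$ (resp. $\beta(\theta)$) be the constant such that $\dim_B E_{\theta,a}=\dim_H E_{\theta,a}=\alpha(\theta)$ for Lebesgue almost all $a\in\Delta_\theta$ (resp. $\dim_B E_{\theta,a}=\dim_H E_{\theta,a}=\beta(\theta)$ for $\nu_\theta$-almost all $a\in\Delta_\theta$). Then $$\alpha(\theta)=\frac{1}{\log2}\lim_{n\to\infty}\frac1n\sum_{\xi_1,\dots,\xi_n=0}^1\frac1{2^n}\log\left(\underline e A_{\xi_1}\cdots A_{\xi_n}\underline e\right),$$ $$\beta(\theta)=\frac{1}{\log2}\lim_{n\to\infty}\frac1n\sum_{\xi_1,\dots,\xi_n=0}^1\frac1{3^n}\,\underline e A_{\xi_1}\cdots A_{\xi_n}\underline p\,\log\left(\underline e A_{\xi_1}\cdots A_{\xi_n}\underline p\right),$$ where $\underline e=(1,\dots,1)$ and $\underline p$ is the unique probability vector with $(A_0+A_1)\underline p=3\underline p$.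
   Context: $\Delta\subset\mathbb{R}^2$ is the Sierpiński gasket: the unique non-empty compact set with $\Delta=S_0(\Delta)\cup S_1(\Delta)\cup S_2(\Delta)$, where $S_0(x,y)=(\frac x2,\frac y2)$, $S_1(x,y)=(\frac x2+\frac12,\frac y2)$, $S_2(x,y)=(\frac x2+\frac14,\frac y2+\frac{\sqrt3}{4})$. For $a\in\mathbb{R}$ let $L_{\theta,a}=\{(x,a+x\tan\theta):x\in\mathbb{R}\}$, $\mathrm{proj}_\theta(x,y)=y-x\tan\theta$, $\Delta_\theta=\mathrm{proj}_\theta(\Delta)$, $E_{\theta,a}=L_{\theta,a}\cap\Delta$. $\nu$ is the unique Borel probability measure with $\nu=\sum_{i=0}^2\frac13\,\nu\circ S_i^{-1}$ and $\nu_\theta=\nu\circ\mathrm{proj}_\theta^{-1}$. For the angles considered, constants $\alpha(\theta),\beta(\theta)$ with the stated almost-everywhere properties exist. Matrices: let $f_0(t)=\frac t2$, $f_1(t)=\frac t2+\frac12$, $f_2(t)=\frac t2-\frac{p}{2q}$. For $k=1,\dots,p+q$ let $I_k=[1-\frac kq,1-\frac{k-1}q]$, $I_k^0=[1-\frac{2k-1}{2q},1-\frac{k-1}{q}]$ (upper half), $I_k^1=[1-\frac kq,1-\frac{2k-1}{2q}]$ (lower half). For $n\in\{0,1\}$ let $A_n$ be the $(p+q)\times(p+q)$ matrix with entries $(A_n)_{i,j}=\sharp\{k\in\{0,1,2\}: f_k(I_j)=I_i^n\}$. Vectors to the left of a matrix are row vectors, to the right column vectors. *)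

(* Defs.v *)
From HB Require Import structures.
From mathcomp Require Import all_boot all_order all_algebra.
From mathcomp Require Import all_classical all_reals all_analysis.

Set Implicit Arguments.
Unset Strict Implicit.
Unset Printing Implicit Defensive.

Import Order.TTheory GRing.Theory Num.Theory.
Import numFieldNormedType.Exports.

Local Open Scope classical_set_scope.
Local Open Scope ring_scope.

(* The norm of [R * R] in the library is the max norm, hence the explicit
   Euclidean distance. *)
Definition dist2 (R : realType) (x y : R * R) : R :=
  Num.sqrt ((x.1 - y.1) ^+ 2 + (x.2 - y.2) ^+ 2).

(* The diameter of [set0] is [-oo]. *)
Definition diam (R : realType) (U : set (R * R)) : \bar R :=
  ereal_sup [set (dist2 x y)%:E | x in U & y in U].

(* Empty members of the cover contribute nothing, also when [s = 0]. *)
Definition hausdorff_content (R : realType) (s delta : R) (F : set (R * R))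
    : \bar R :=
  ereal_inf [set (\sum_(0 <= i <oo | U i != set0) diam (U i) `^ s)%E |
    U in [set U : nat -> set (R * R) |
           (forall i, (diam (U i) <= delta%:E)%E) /\ F `<=` \bigcup_i U i]].

Definition hausdorff_measure (R : realType) (s : R) (F : set (R * R))
    : \bar R :=
  ereal_sup [set hausdorff_content s delta F | delta in [set d : R | 0 < d]].

Definition hausdorff_dim (R : realType) (F : set (R * R)) : \bar R :=
  ereal_inf [set s%:E | s in [set s : R |
                                0 <= s /\ hausdorff_measure s F = 0%E]].

Definition covering_number (R : realType) (F : set (R * R)) (delta : R)
    : \bar R :=
  ereal_inf [set (n%:R : R)%:E | n in [set n : nat |
    exists U : 'I_n -> set (R * R),
      (forall i, (diam (U i) <= delta%:E)%E) /\ F `<=` \bigcup_i U i]].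

(* The box dimension of [F] exists and is equal to [d]. *)
Definition has_box_dim (R : realType) (F : set (R * R)) (d : R) : Prop :=
  (lne (covering_number F delta) * ((- ln delta)^-1)%:E)%E
    @[delta --> 0^'+] --> d%:E.

Definition gasket_map (R : realType) (i : 'I_3) (z : R * R) : R * R :=
  if i == 0 :> nat then (z.1 / 2, z.2 / 2)
  else if i == 1 :> nat then (z.1 / 2 + 1 / 2, z.2 / 2)
  else (z.1 / 2 + 1 / 4, z.2 / 2 + Num.sqrt 3 / 4).

(* These properties determine [D]. *)
Definition is_gasket (R : realType) (D : set (R * R)) : Prop :=
  [/\ D !=set0, compact D & D = \bigcup_i (gasket_map i @` D)].

(* The product of the Borel sigma-algebras is the Borel sigma-algebra of the
   plane; among probability measures on it, this equation determines [nu]. *)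
Definition is_gasket_measure (R : realType)
    (nu : probability (measurableTypeR R * measurableTypeR R)%type R) : Prop :=
  forall B, measurable B ->
    nu B = (\sum_(i < 3) (3^-1)%:E * nu (@gasket_map R i @^-1` B))%E.

Definition proj_angle (R : realType) (theta : R) (z : R * R) : R :=
  z.2 - z.1 * tan theta.

Definition line (R : realType) (theta a : R) : set (R * R) :=
  [set (x, a + x * tan theta) | x in [set: R]].

Definition slice (R : realType) (D : set (R * R)) (theta a : R)
    : set (R * R) :=
  line theta a `&` D.

Definition has_dims (R : realType) (F : set (R * R)) (d : R) : Prop :=
  has_box_dim F d /\ hausdorff_dim F = d%:E.

Definition ae_slice_dim (R : realType) (mu : set (measurableTypeR R) -> \bar R)
    (D : set (R * R)) (theta d : R) : Prop :=
  {ae mu, forall a, (proj_angle theta @` D) a -> has_dims (slice D theta a) d}.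

Definition branch (R : realType) (p q : nat) (k : 'I_3) (t : R) : R :=
  if k == 0 :> nat then t / 2
  else if k == 1 :> nat then t / 2 + 1 / 2
  else t / 2 - p%:R / (2 * q%:R).

Definition Iint (R : realType) (q k : nat) : set R :=
  `[1 - k%:R / q%:R, 1 - (k%:R - 1) / q%:R]%classic.

(* The upper half for [n = 0], the lower half for [n = 1]. *)
Definition Ihalf (R : realType) (q k : nat) (n : 'I_2) : set R :=
  if n == 0 :> nat then
    `[1 - (2 * k%:R - 1) / (2 * q%:R), 1 - (k%:R - 1) / q%:R]%classic
  else `[1 - k%:R / q%:R, 1 - (2 * k%:R - 1) / (2 * q%:R)]%classic.

(* Row and column indices are shifted: the ordinal [i] stands for [i + 1]. *)
Definition Amx (R : realType) (p q : nat) (n : 'I_2) : 'M[R]_(p + q) :=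
  \matrix_(i, j)
    #|[pred k : 'I_3 | branch p q k @` @Iint R q j.+1 == Ihalf q i.+1 n]|%:R.

Definition Aword (R : realType) (p q n : nat) (xi : n.-tuple 'I_2)
    : 'M[R]_(p + q) :=
  \big[mulmx/1%:M]_(x <- xi) Amx R p q x.

Definition is_prob_vec (R : realType) (m : nat) (v : 'cV[R]_m) : Prop :=
  (forall i, 0 <= v i 0) /\ \sum_i v i 0 = 1.

Definition is_pvec (R : realType) (p q : nat) (v : 'cV[R]_(p + q)) : Prop :=
  is_prob_vec v /\ (Amx R p q ord0 + Amx R p q ord_max) *m v = 3 *: v.

(* [e A_xi v], with [e] the row vector of ones *)
Definition word_weight (R : realType) (p q n : nat) (xi : n.-tuple 'I_2)
    (v : 'cV[R]_(p + q)) : R :=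
  ((const_mx 1 : 'rV[R]_(p + q)) *m Aword R p q xi *m v) 0 0.

Definition alpha_seq (R : realType) (p q n : nat) : R :=
  n%:R^-1 * \sum_(xi : n.-tuple 'I_2)
    (2 ^+ n)^-1 * ln (word_weight xi (const_mx 1 : 'cV[R]_(p + q))).

Definition beta_seq (R : realType) (p q : nat) (v : 'cV[R]_(p + q)) (n : nat)
    : R :=
  n%:R^-1 * \sum_(xi : n.-tuple 'I_2)
    (3 ^+ n)^-1 * (word_weight xi v * ln (word_weight xi v)).

(* Main.v *)
(* Let [height] be the affine function on the plane with values [q], [p + q] and
   [0] at the vertices of the gasket; up to an affine change of variable it is
   the projection along the lines [L_(theta, a)].  It maps the gasket onto
   [[0, p + q]], and the cells of level [n] onto intervals with end points in
   [2^-n Z].  Hence the number of cells of level [n] that meet a line depends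
   only on the integer part of [2^n height], and it is an entry of
   [A_xi1 ... A_xin e].  Since a set of diameter about [2^-n] meets a bounded
   number of cells, the logarithm of this count divided by [n] tends to
   [dim_B * ln 2] whenever the box dimension of the slice exists.  As it is also
   bounded, the convergence holds in the mean, both for Lebesgue measure and for
   [nu]; an interval of level [n] has mass proportional to [2^-n] for the former
   and [3^-n (A_xi1 ... A_xin pv)_i] for the latter, where [pv] is the vector of
   masses of the unit intervals.  Replacing the logarithm of an entry by that of
   the sum of the entries costs [O(1/n)]. *)
Require Import Defs.
From HB Require Import structures.
From mathcomp Require Import all_boot all_order all_algebra.
From mathcomp Require Import all_classical all_reals all_analysis.
From mathcomp Require Import measurable_realfun.
From mathcomp Require Import zify ring lra.

Set Implicit Arguments.
Unset Strict Implicit.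
Unset Printing Implicit Defensive.

Import Order.TTheory GRing.Theory Num.Theory.
Import numFieldNormedType.Exports.

Local Open Scope classical_set_scope.
Local Open Scope ring_scope.

(** * Digit expansions and products of the matrices [A_n] *)

Section radix.
Variables (T : Type) (f : T -> nat).

(** The head is the most significant digit. Digits may exceed 1, as they do for [shift], so several
    words can share a value. *)
Fixpoint radix (w : seq T) : nat :=
  if w is x :: w' then (f x * 2 ^ size w' + radix w')%N else 0%N.

(** The geometric sum [b * (2 ^ n - 1)], with [b] moved to the left to avoid truncated
    subtraction. *)
Lemma radix_le b w : (forall x, (f x <= b)%N) ->
  (radix w + b <= 2 ^ size w * b)%N.
Proof.
move=> fb; elim: w => [|x w IH] /=; first by rewrite expn0 mul1n.
rewrite expnS -addnA mul2n -addnn mulnDl; apply: leq_add => //.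
by rewrite mulnC leq_mul2l fb orbT.
Qed.

Lemma radix_lt w : (forall x, (f x <= 1)%N) -> (radix w < 2 ^ size w)%N.
Proof. by move=> /(radix_le w); rewrite muln1 addn1. Qed.

End radix.

Lemma radix_cons_inj (T : Type) (f : T -> nat) x y v w :
  (forall z, (f z <= 1)%N) -> size v = size w ->
  radix f (x :: v) = radix f (y :: w) -> f x = f y /\ radix f v = radix f w.
Proof.
move=> f1 svw /=; have := radix_lt v f1; have := radix_lt w f1.
rewrite svw; move: (f1 x) (f1 y).
by case: (f x) => [|[|//]] _; case: (f y) => [|[|//]] _; lia.
Qed.

(** The values of [height] at the fixed points of the three maps; in the coordinate [height], the
    map [k] is [y |-> (y + shift p q k) / 2]. *)
Definition shift (p q : nat) (k : 'I_3) : nat :=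
  if k == 0 :> nat then q else if k == 1 :> nat then (p + q)%N else 0%N.

Lemma shift_le p q k : (shift p q k <= p + q)%N.
Proof. by rewrite /shift; case: ifP => // _; [exact: leq_addl|case: ifP]. Qed.

Lemma sum_tupleS (V : nmodType) (T : finType) n (F : seq T -> V) :
  \sum_(w : n.+1.-tuple T) F w =
  \sum_(x : T) \sum_(w : n.-tuple T) F (x :: w).
Proof.
rewrite pair_big /= (reindex (fun u : T * n.-tuple T => [tuple of u.1 :: u.2])).
  exact: eq_bigr.
exists (fun w => (thead w, [tuple of behead w])) => [[x w] _|w _] /=.
  by rewrite theadE; congr pair; apply: val_inj.
by rewrite [RHS]tuple_eta; apply: val_inj.
Qed.

Lemma sum_tuple0 (V : nmodType) (T : finType) (F : seq T -> V) :
  \sum_(w : 0.-tuple T) F w = F [::].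
Proof.
rewrite (bigD1 [tuple]) //= big1 ?addr0 // => w.
by case/eqP; exact: tuple0.
Qed.

Lemma sum_radix (V : nmodType) n (G : nat -> V) :
  \sum_(w : n.-tuple 'I_2) G (radix val w) = \sum_(0 <= r < 2 ^ n) G r.
Proof.
elim: n G => [|n IH] G.
  by rewrite (sum_tuple0 (fun w => G (radix val w))) expn0 big_nat1.
rewrite (sum_tupleS n (fun w => G (radix val w))) /= !big_ord_recl big_ord0 addr0.
rewrite expnS mul2n -addnn.
rewrite (@big_cat_nat _ _ _ (2 ^ n)) ?leq_addr //=; congr (_ + _).
  by rewrite -IH; apply: eq_bigr => w _; rewrite mul0n.
rewrite -[X in \sum_(X <= _ < _) _]add0n big_addn addnK -(IH (fun r => G (r + 2 ^ n)%N)).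
by apply: eq_bigr => w _; rewrite size_tuple mul1n addnC.
Qed.

(** Passes from matrix indexing (a row [i] and a binary word) to the numbering of the intervals of
    level [n]: integer part and binary digits of [M / 2 ^ n]. *)
Lemma sum_cells (V : nmodType) m n (G : nat -> V) :
  \sum_(i < m) \sum_(w : n.-tuple 'I_2) G (i * 2 ^ n + radix val w)%N =
  \sum_(M < m * 2 ^ n) G M.
Proof.
rewrite -[RHS](big_mkord xpredT G) big_nat_mul [RHS]big_mkord.
apply: eq_bigr => i _; rewrite (sum_radix n (fun r => G (i * 2 ^ n + r)%N)).
rewrite -[X in _ = \sum_(X <= _ < _) _]add0n big_addn mulSn addnK.
by apply: eq_bigr => r _; rewrite addnC.
Qed.

Section transfer_matrix.
Variables (R : realType) (p q : nat).
Hypothesis q_gt0 : (0 < q)%N.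

Lemma itv_image_half (c lo hi : R) :
  [set t / 2 + c | t in `[lo, hi]%classic] =
  `[lo / 2 + c, hi / 2 + c]%classic :> set R.
Proof.
apply/seteqP; split=> [_ [t /= + <-]|t /=]; rewrite in_itv /= => /andP[h1 h2].
  by rewrite in_itv /=; apply/andP; split; lra.
exists (2 * (t - c)) => /=; last by lra.
by rewrite in_itv /=; apply/andP; split; lra.
Qed.

Lemma itv_translate_eq (a b l : R) : 0 <= l ->
  (`[a - l, a]%classic == `[b - l, b]%classic :> set R) = (a == b).
Proof.
move=> l0; apply/eqP/eqP => [ab|->//].
have : `[b - l, b]%classic a by rewrite -ab /= in_itv /=; apply/andP; split; lra.
have : `[a - l, a]%classic b by rewrite ab /= in_itv /=; apply/andP; split; lra.
by rewrite /= !in_itv /=; lra.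
Qed.

(** The change of variable [y = q (1 - t)] sends [I_k] to [[k - 1, k]] and makes each branch of the
    form [y |-> (y + c) / 2] with an integer [c]. All intervals compared have length [1 / (2 q)], so
    equality is decided by one end point. *)
Lemma AmxE n i j : Amx R p q n i j =
  \sum_(k < 3) ((j + shift p q k == i * 2 + n)%N%:R : R).
Proof.
have eq_itv (a b a' b' : R) : a = a' -> b = b' ->
  `[a, b]%classic = `[a', b']%classic by move=> -> ->.
have q0 : q%:R != 0 :> R by rewrite pnatr_eq0 -lt0n.
have hl : 0 <= (2 * q%:R)^-1 :> R by rewrite invr_ge0 mulr_ge0.
have IE : @Ihalf R q i.+1 n =
    `[1 - (i * 2 + n)%:R / (2 * q%:R) - (2 * q%:R)^-1,
      1 - (i * 2 + n)%:R / (2 * q%:R)]%classic.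
  rewrite /Ihalf; case: n => -[|[|//]] hn /=; apply: eq_itv;
  by rewrite ?natrD ?natrM -(natr1 i); field.
(* The constants [c] in the order of [branch]: those of [shift] with the indices 1 and 2 exchanged,
   which leaves the sum over [k] unchanged. *)
pose top (k : 'I_3) : nat :=
  if k == 0 :> nat then q else if k == 1 :> nat then 0%N else (p + q)%N.
have bE k : branch p q k @` @Iint R q j.+1 =
    `[1 - (j + top k)%:R / (2 * q%:R)
        - (2 * q%:R)^-1,
      1 - (j + top k)%:R / (2 * q%:R)]%classic.
  have -> : branch p q k = fun t : R => t / 2 +
      (if k == 0 :> nat then 0 else if k == 1 :> nat then 1 / 2
       else - (p%:R / (2 * q%:R))).
    by apply/funext => t; rewrite /branch; do 2?[case: ifP => _]; rewrite ?addr0.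
  rewrite /Iint itv_image_half.
  by apply: eq_itv; rewrite /top; do 2?[case: ifP => _]; rewrite ?natrD -(natr1 j); field.
rewrite mxE -sum1_card natr_sum big_mkcond /=.
have E k : (branch p q k @` @Iint R q j.+1 == @Ihalf R q i.+1 n) =
    (j + top k == i * 2 + n)%N.
  rewrite bE IE itv_translate_eq //; apply/eqP/eqP => [|->//].
  move=> h; apply/eqP; rewrite -(eqr_nat R); apply/eqP.
  have : forall x y : R, 1 - x / (2 * q%:R) = 1 - y / (2 * q%:R) -> x = y.
    by move=> x y /addrI /oppr_inj /(mulIf _) -> //; rewrite invr_eq0 mulf_neq0.
  exact.
have Em (b : bool) : (if b then 1%:R else 0 : R) = b%:R by case: b.
rewrite !big_ord_recl !big_ord0 !addr0 /in_mem /= !E /= !Em /shift /top /=.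
by rewrite [in RHS](addrC (((j + (p + q))%N == _)%:R)).
Qed.

Lemma AwordS n x (w : n.-tuple 'I_2) :
  Aword R p q [tuple of x :: w] = Amx R p q x *m Aword R p q w.
Proof. by rewrite /Aword /= big_cons. Qed.

(* Both the number of cells meeting a line and the mass of a dyadic interval
   obey this recursion. *)
Lemma Aword_cascade (Phi : nat -> int -> R) :
  (forall n M, Phi n.+1 M =
     \sum_(k < 3) Phi n (M - (shift p q k * 2 ^ n)%N%:Z)) ->
  (forall n M, ~~ (0 <= M < ((p + q) * 2 ^ n)%N%:Z) -> Phi n M = 0) ->
  forall n (w : n.-tuple 'I_2) i,
    (Aword R p q w *m (\col_j Phi 0%N j%:Z)) i 0 =
    Phi n (i * 2 ^ n + radix val w)%N%:Z.
Proof.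
move=> PhiS Phi0; elim=> [|n IH] w i.
  by rewrite tuple0 /Aword big_nil mul1mx mxE expn0 muln1 addn0.
case/tupleP: w => x v; rewrite AwordS -mulmxA mxE /= size_tuple.
under eq_bigr => j _ do rewrite IH AmxE mulr_suml.
rewrite exchange_big PhiS /=; apply: eq_bigr => k _.
have vlt : (radix val v < 2 ^ n)%N.
  by rewrite -{2}(size_tuple v); apply: radix_lt => -[].
set A := radix val v in vlt *.
(* For a given [k] only [j = 2 i + x - shift k] can contribute; if it is not a valid index, the
   matching value of [Phi] lies outside its support. *)
have [cm|cm] := boolP ((shift p q k <= i * 2 + x) &&
                       (i * 2 + x - shift p q k < p + q))%N.
  have [c1 c2] := andP cm.
  rewrite (bigD1 (Ordinal c2)) //= subnK // eqxx mul1r big1 ?addr0 => [|j].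
    by congr (Phi n _); rewrite expnS; nia.
  rewrite -val_eqE /= => jne; case: eqP => [|_]; last by rewrite mul0r.
  by move=> jE; move: jne; rewrite -jE addnK eqxx.
rewrite big1 => [|j _].
  apply/esym/Phi0; move: cm; rewrite expnS; set s := shift _ _ _.
  have := vlt; move: (2 ^ n)%N => N; nia.
case: eqP => [jE|_]; last by rewrite mul0r.
by move: cm; rewrite -jE leq_addl addnK ltn_ord.
Qed.

End transfer_matrix.

(** * Cells of the gasket *)

(** Used as digits in [radix]: for [c = 1, 2] they give [2 ^ n] times the barycentric coordinates of
    the corner of a cell. *)
Definition is_digit (c : nat) (k : 'I_3) : nat := k == c :> nat.

Section gasket_geometry.
Variables (R : realType) (p q : nat).
Hypotheses (p_gt0 : (0 < p)%N) (q_gt0 : (0 < q)%N).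
Implicit Types x y z : R * R.

(* Barycentric coordinates relative to the vertices [(1, 0)] and
   [(1/2, sqrt 3 / 2)]. *)
Definition bary1 z : R := z.1 - z.2 / Num.sqrt 3.
Definition bary2 z : R := 2 * z.2 / Num.sqrt 3.

(* The affine function with values [q], [p + q], [0] at the three vertices: an
   affine reparametrisation of [proj_angle theta], for which the intervals
   [I_k] become the intervals [[k - 1, k]]. *)
Definition height z : R := q%:R + p%:R * bary1 z - q%:R * bary2 z.

Definition triangle : set (R * R) :=
  [set z | [/\ 0 <= bary1 z, 0 <= bary2 z & bary1 z + bary2 z <= 1]].

Definition cell_map (w : seq 'I_3) z : R * R := foldr (@gasket_map R) z w.

Let sqrt3_gt0 : 0 < Num.sqrt 3 :> R. Proof. by rewrite sqrtr_gt0. Qed.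
Let sqrt3_neq0 : Num.sqrt 3 != 0 :> R. Proof. exact: lt0r_neq0. Qed.
Let sqr_sqrt3 : Num.sqrt 3 ^+ 2 = 3 :> R. Proof. exact: sqr_sqrtr. Qed.

Lemma bary1_map k z :
  bary1 (gasket_map k z) = (bary1 z + (is_digit 1 k)%:R) / 2.
Proof. by case: k => -[|[|[|//]]] h; rewrite /bary1 /gasket_map /is_digit /=; field. Qed.

Lemma bary2_map k z :
  bary2 (gasket_map k z) = (bary2 z + (is_digit 2 k)%:R) / 2.
Proof. by case: k => -[|[|[|//]]] h; rewrite /bary2 /gasket_map /is_digit /=; field. Qed.

Lemma height_map k z :
  height (gasket_map k z) = (height z + (shift p q k)%:R) / 2.
Proof.
rewrite /height bary1_map bary2_map /shift /is_digit.
by case: k => -[|[|[|//]]] h /=; rewrite ?natrD; field.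
Qed.

(** Serves [bary1], [bary2] and [height] alike, which differ only in their digits. *)
Lemma cell_map_affine (F : R * R -> R) (f : 'I_3 -> nat) w z :
  (forall k z, F (gasket_map k z) = (F z + (f k)%:R) / 2) ->
  F (cell_map w z) = (F z + (radix f w)%:R) / 2 ^+ size w.
Proof.
move=> Ff; elim: w => [|k w IH] /=; first by rewrite addr0 divr1.
rewrite Ff IH exprS natrD natrM natrX; field.
by rewrite expf_neq0.
Qed.

Let sqrt3_ge1 : 1 <= Num.sqrt 3 :> R.
Proof. by rewrite -[leLHS]sqrtr1 ler_wsqrtr // ler1n. Qed.

Lemma coord1_dist x y : `|x.1 - y.1| <= dist2 x y.
Proof. by rewrite -sqrtr_sqr ler_wsqrtr // lerDl sqr_ge0. Qed.

Lemma coord2_dist x y : `|x.2 - y.2| <= dist2 x y.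
Proof. by rewrite -sqrtr_sqr ler_wsqrtr // lerDr sqr_ge0. Qed.

Let coord2_dist3 x y : `|(x.2 - y.2) / Num.sqrt 3| <= dist2 x y.
Proof.
rewrite normrM normfV (gtr0_norm sqrt3_gt0) ler_pdivrMr //.
apply: le_trans (coord2_dist x y) _.
by rewrite ler_peMr //; exact: sqrtr_ge0.
Qed.

Lemma bary1_dist x y : `|bary1 x - bary1 y| <= 2 * dist2 x y.
Proof.
have -> : bary1 x - bary1 y = (x.1 - y.1) - (x.2 - y.2) / Num.sqrt 3.
  by rewrite /bary1; field.
apply: le_trans (ler_normB _ _) _; rewrite mulr_natl mulr2n.
by apply: lerD; [exact: coord1_dist|exact: coord2_dist3].
Qed.

Lemma bary2_dist x y : `|bary2 x - bary2 y| <= 2 * dist2 x y.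
Proof.
have -> : bary2 x - bary2 y = 2 * ((x.2 - y.2) / Num.sqrt 3).
  by rewrite /bary2; field.
by rewrite normrM ger0_norm // ler_pM2l.
Qed.

(** Two sides of the triangle are unit vectors at an angle of 60 degrees, so the squared distance is
    [a ^ 2 + a b + b ^ 2], at most [3 e ^ 2]. *)
Lemma dist2_bary x y e : `|bary1 x - bary1 y| <= e -> `|bary2 x - bary2 y| <= e ->
  dist2 x y <= 2 * e.
Proof.
move=> h1 h2; have e0 : 0 <= e by apply: le_trans h1.
rewrite /dist2 -(ger0_norm (mulr_ge0 _ e0)) // -sqrtr_sqr.
apply: ler_wsqrtr; set a := bary1 x - bary1 y; set b := bary2 x - bary2 y.
have -> : (x.1 - y.1) ^+ 2 + (x.2 - y.2) ^+ 2 = a ^+ 2 + a * b + b ^+ 2.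
  rewrite /a /b /bary1 /bary2 -[_ ^+ 2 in RHS]mulr1.
  have -> : (x.1 - y.1) ^+ 2 + (x.2 - y.2) ^+ 2 =
    (x.1 - y.1) ^+ 2 + Num.sqrt 3 ^+ 2 * ((x.2 - y.2) / Num.sqrt 3) ^+ 2 by field.
  by rewrite sqr_sqrt3; field.
rewrite -/a -/b in h1 h2; move: h1 h2; rewrite !ler_norml => /andP[? ?] /andP[? ?].
nra.
Qed.

Lemma height_ge0 z : triangle z -> 0 <= height z.
Proof.
case=> u0 v0 uv; rewrite /height.
have : 0 <= p%:R * bary1 z by rewrite mulr_ge0.
have : 0 <= q%:R * (1 - bary2 z) by rewrite mulr_ge0 // subr_ge0; lra.
by lra.
Qed.

Lemma height_le z : triangle z -> height z <= (p + q)%N%:R.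
Proof.
case=> u0 v0 uv; rewrite /height natrD.
have : 0 <= q%:R * bary2 z by rewrite mulr_ge0.
have : 0 <= p%:R * (1 - bary1 z) by rewrite mulr_ge0 // subr_ge0; lra.
by lra.
Qed.

(** [p + q - height z] equals [p (1 - bary1 z) + q bary2 z]; both terms are nonnegative, so both
    vanish. *)
Lemma height_top z : triangle z -> (p + q)%N%:R <= height z -> z = (1, 0).
Proof.
case=> u0 v0 uv; rewrite /height natrD => h.
have p0 : 0 < p%:R :> R by rewrite ltr0n.
have q0 : 0 < q%:R :> R by rewrite ltr0n.
have h1 : 0 <= q%:R * bary2 z by rewrite mulr_ge0.
have h2 : 0 <= p%:R * (1 - bary1 z) by rewrite mulr_ge0 // subr_ge0; lra.
have /eqP : q%:R * bary2 z = 0 by lra.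
have /eqP : p%:R * (1 - bary1 z) = 0 by lra.
rewrite !mulf_eq0 !(gt_eqF p0) !(gt_eqF q0) /= subr_eq0 invr_eq0.
rewrite (negPf sqrt3_neq0) orbF pnatr_eq0 /= /bary1 => /eqP + /eqP z2.
by rewrite z2 mul0r subr0 => z1; rewrite [z]surjective_pairing -z1 z2.
Qed.

Lemma triangle_cell w z : triangle z ->
  (radix (is_digit 1) w)%:R <=
    bary1 (cell_map w z) * 2 ^+ size w <=
  (radix (is_digit 1) w)%:R + 1 /\
  (radix (is_digit 2) w)%:R <=
    bary2 (cell_map w z) * 2 ^+ size w <=
  (radix (is_digit 2) w)%:R + 1.
Proof.
move=> [u0 v0 uv].
rewrite (cell_map_affine _ _ bary1_map) (cell_map_affine _ _ bary2_map).
rewrite !divfK ?expf_neq0 //; split; apply/andP; split; lra.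
Qed.

(** A cell is determined by its corner: leading binary digits can be read off, and the two
    indicators determine the letter. *)
Lemma radix_bary_inj n (v w : n.-tuple 'I_3) :
  radix (is_digit 1) v =
    radix (is_digit 1) w ->
  radix (is_digit 2) v =
    radix (is_digit 2) w -> v = w.
Proof.
elim: n v w => [|n IH] v w; first by rewrite (tuple0 v) (tuple0 w).
case/tupleP: v => x v; case/tupleP: w => y w.
have le1 c k : (is_digit c k <= 1)%N by rewrite /is_digit; case: eqP.
have svw : size v = size w by rewrite !size_tuple.
move=> /(radix_cons_inj (le1 1%N) svw)[x1 vw1].
move=> /(radix_cons_inj (le1 2%N) svw)[x2 vw2].
have -> : x = y.
  apply: val_inj; move: x1 x2; rewrite /is_digit.
  by case: x => -[|[|[|//]]] h; case: y => -[|[|[|//]]] h'.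
by rewrite (IH v w).
Qed.

Section attractor.
Variables (D : set (R * R)).
Hypothesis gasketD : is_gasket D.

Lemma gasket_cellP z : D z -> exists k z', D z' /\ z = gasket_map k z'.
Proof.
case: gasketD => _ _ {1}-> [k _ [z' Dz' <-]].
by exists k, z'.
Qed.

Lemma gasket_map_in k z : D z -> D (gasket_map k z).
Proof.
by case: gasketD => _ _ DE Dz; rewrite DE; exists k => //; exists z.
Qed.

Lemma cell_map_in w z : D z -> D (cell_map w z).
Proof. by move=> Dz; elim: w => //= k w; exact: gasket_map_in. Qed.

Lemma gasket_min_attained (F : R * R -> R) : continuous F ->
  exists2 c, D c & forall z, D z -> F c <= F z.
Proof.
case: gasketD => D0 cD _ cF.
have [c] := compact_EVT_min D0 cD (continuous_subspaceT cF).
rewrite inE => Dc Fc; exists c => // z Dz.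
by apply: Fc; rewrite inE.
Qed.

(* At a minimum [c] of [F] one gets [F c >= F c / 2]. *)
Lemma gasket_ge0 (F : R * R -> R) : continuous F ->
  (forall k z, F z / 2 <= F (gasket_map k z)) -> forall z, D z -> 0 <= F z.
Proof.
move=> cF Fk z Dz; have [c Dc cmin] := gasket_min_attained cF.
have [k [z' [Dz' cE]]] := gasket_cellP Dc.
have := Fk k z'; rewrite -cE; have := cmin _ Dz'; have := cmin _ Dz; lra.
Qed.

Lemma continuous_bary1 : continuous bary1.
Proof.
move=> z; apply: cvgB; first exact: cvg_fst.
by apply: cvgM; [exact: cvg_snd|exact: cvg_cst].
Qed.

Lemma continuous_bary2 : continuous bary2.
Proof.
move=> z; apply: cvgM; last exact: cvg_cst.
by apply: cvgM; [exact: cvg_cst|exact: cvg_snd].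
Qed.

Lemma continuous_height : continuous height.
Proof.
move=> z; apply: cvgB; last first.
  by apply: cvgM; [exact: cvg_cst|exact: continuous_bary2].
apply: cvgD; first exact: cvg_cst.
by apply: cvgM; [exact: cvg_cst|exact: continuous_bary1].
Qed.

(** [gasket_ge0] applies to each of the three affine functions that cut out the triangle. *)
Lemma gasket_triangle : D `<=` triangle.
Proof.
move=> z Dz; split.
- apply: (gasket_ge0 continuous_bary1 _ Dz) => k x; rewrite bary1_map.
  by rewrite ler_pM2r // lerDl.
- apply: (gasket_ge0 continuous_bary2 _ Dz) => k x; rewrite bary2_map.
  by rewrite ler_pM2r // lerDl.
- rewrite -subr_ge0.
  have cF : continuous (fun z => 1 - (bary1 z + bary2 z)).
    move=> x; apply: cvgB; first exact: cvg_cst.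
    by apply: cvgD; [exact: continuous_bary1|exact: continuous_bary2].
  apply: (gasket_ge0 cF _ Dz) => k x; rewrite bary1_map bary2_map /is_digit.
  by case: k => -[|[|[|//]]] h /=; lra.
Qed.

Lemma ler0_of_expn2 (x C : R) : (forall n, x * 2 ^+ n <= C) -> x <= 0.
Proof.
move=> H; rewrite leNgt; apply/negP => x0.
have C0 : 0 <= C by have := H 0%N; rewrite expr0; lra.
have := H (Num.bound (C / x)); apply/negP; rewrite -ltNge mulrC -ltr_pdivrMr //.
apply: lt_trans (archi_boundP _) _; first by rewrite divr_ge0 // ltW.
by rewrite -natrX ltr_nat ltn_expl.
Qed.

(** By compactness [|height - y|] has a minimum on [D]. It is zero because following the digits of
    [y] yields points of [D] with error at most [(p + q) / 2 ^ n]. *)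
Lemma height_surj (y : R) : 0 <= y <= (p + q)%N%:R -> exists2 z, D z & height z = y.
Proof.
move=> yr.
have cF : continuous (fun z => `|height z - y|).
  move=> x; apply: cvg_norm; apply: cvgB; last exact: cvg_cst.
  exact: continuous_height.
have [c Dc cmin] := gasket_min_attained cF.
exists c => //; apply/eqP; rewrite -subr_eq0 -normr_le0.
apply: (@ler0_of_expn2 _ (p + q)%N%:R) => n.
have [z Dz zy] : exists2 z, D z & `|height z - y| * 2 ^+ n <= (p + q)%N%:R.
  elim: n y yr {cF cmin} => [|n IH] y /andP[y0 ym].
    exists c => //; rewrite mulr1.
    have := height_ge0 (gasket_triangle Dc); have := height_le (gasket_triangle Dc).
    by rewrite ler_norml; lra.
  have [k yk] : exists k : 'I_3, 0 <= 2 * y - (shift p q k)%:R <= (p + q)%N%:R.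
    (* The images of the range under the maps of shift 0 and [p + q] are its two halves, so these
       two maps suffice. *)
    have [ym2|ym2] := leP (2 * y) (p + q)%N%:R.
      by exists (@Ordinal 3 2 isT); rewrite /shift /= subr0; lra.
    by exists (@Ordinal 3 1 isT); rewrite /shift /=; lra.
  have [z Dz zy] := IH _ yk.
  exists (gasket_map k z); first exact: gasket_map_in.
  apply: le_trans zy; rewrite height_map exprS.
  have -> : (height z + (shift p q k)%:R) / 2 - y =
    2^-1 * (height z - (2 * y - (shift p q k)%:R)) by field.
  by rewrite normrM ger0_norm // mulrACA mulVf // mul1r.
by apply: le_trans zy; rewrite ler_wpM2r // cmin.
Qed.

Let vertex : 'I_3 -> R * R := fun k =>
  if k == 0 :> nat then (0, 0) else if k == 1 :> nat then (1, 0)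
  else (1 / 2, Num.sqrt 3 / 2).

Let vertex_fixed k : gasket_map k (vertex k) = vertex k.
Proof.
by case: k => -[|[|[|//]]] h; rewrite /gasket_map /vertex /=; congr pair; field.
Qed.

Let triangle_vertex k : triangle (vertex k).
Proof.
have e1 : Num.sqrt 3 / 2 / Num.sqrt 3 = 1 / 2 :> R by field.
have e2 : 2 * (Num.sqrt 3 / 2) / Num.sqrt 3 = 1 :> R by field.
by case: k => -[|[|[|//]]] h; rewrite /triangle /vertex /bary1 /bary2 /= ?e1 ?e2;
  split; rewrite ?mul0r ?mulr0 ?mul0r; lra.
Qed.

(* A point of [D] that is the top vertex of its cell is also a vertex of another
   cell, where it lies strictly below the top. *)
Lemma below_top_cell n z : D z -> height z < (p + q)%N%:R ->
  exists (w : n.-tuple 'I_3) z',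
    [/\ triangle z', height z' < (p + q)%N%:R & z = cell_map w z'].
Proof.
(* The induction is widened to include the vertices, since passing to another cell may produce one
   of them. *)
move=> Dz; have {Dz}: D z \/ exists k, z = vertex k by left.
elim: n z => [|n IH] z Dz zt.
  exists [tuple], z; split=> //.
  by case: Dz => [/gasket_triangle//|[k ->]]; exact: triangle_vertex.
suff [k [z' [Dz' z't ->]]] : exists k z', [/\ D z' \/ exists k, z' = vertex k,
    height z' < (p + q)%N%:R & z = gasket_map k z'].
  have [w [z'' [? ? ->]]] := IH _ Dz' z't.
  by exists [tuple of k :: w], z''.
case: Dz zt => [Dz|[k ->] kt]; last first.
  by exists k, (vertex k); split; [right; exists k|exact: kt|rewrite vertex_fixed].
have [k [z' [Dz' ->]]] := gasket_cellP Dz.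
have [z't|z't] := ltP (height z') (p + q)%N%:R.
  by exists k, z'; split=> //; left.
have hv (k' : 'I_3) : k' != 1%N :> nat -> height (vertex k') < (p + q)%N%:R.
  move=> k1; have := height_map k' (vertex k').
  rewrite vertex_fixed; have : (shift p q k')%:R < (p + q)%N%:R :> R.
    rewrite ltr_nat /shift (negPf k1); case: ifP => _.
      by rewrite -[ltnLHS]add0n ltn_add2r.
    by rewrite addn_gt0 q_gt0 orbT.
  by lra.
(* Here [z] is the image under map [k] of vertex 1. If [k = 1] it is vertex 1 itself, against the
   bound on its height; otherwise it is also the image under map 1 of vertex [k]. *)
rewrite (height_top (gasket_triangle Dz') z't).
have [k1|k1] := eqVneq (k : nat) 1%N.
  rewrite height_map (_ : height (1, 0) = (p + q)%N%:R) /shift ?k1 /=; first by lra.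
  by rewrite /height /bary1 /bary2 /= natrD; field.
exists (@Ordinal 3 1 isT), (vertex k); split; [by right; exists k|exact: hv|].
by case: k k1 {zt} => -[|[|[|//]]] h // _; rewrite /gasket_map /vertex /=; congr pair; lra.
Qed.

End attractor.
End gasket_geometry.

(** * Covering numbers of slices *)

Section crossing.
Variables (R : realType) (p q : nat).
Hypotheses (p_gt0 : (0 < p)%N) (q_gt0 : (0 < q)%N).

(* The words [w] such that the level-[n] dyadic interval
   [[M / 2 ^ n, (M + 1) / 2 ^ n]] lies in the range of [height] on the cell
   [w]. *)
Definition crossing n (M : int) : {set n.-tuple 'I_3} :=
  [set w : n.-tuple 'I_3 |
    0 <= M - (radix (shift p q) w)%:Z < (p + q)%:Z]%SET.

Lemma crossing_floor n (y : R) (w : n.-tuple 'I_3) :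
  (w \in crossing n (Num.floor (y * 2 ^+ n))) =
  (0 <= y * 2 ^+ n - (radix (shift p q) w)%:R < (p + q)%N%:R).
Proof.
rewrite inE subr_ge0 floor_ge_int pmulrn ltrBlDr floor_lt_int.
by rewrite subr_ge0 ltrBlDr rmorphD /= -!pmulrn.
Qed.

(** Relative to a fixed word of [A], each of the two corner coordinates takes at most 11 values,
    whence [121 = 11 ^ 2]. *)
Lemma card_nearby n (A : {set n.-tuple 'I_3}) :
  (forall c : nat, c \in [:: 1; 2]%N -> forall v w, v \in A -> w \in A ->
    (radix (is_digit c) v <=
     radix (is_digit c) w + 5)%N) ->
  (#|A| <= 121)%N.
Proof.
move=> near; have [->|[w0 w0A]] := set_0Vmem A; first by rewrite cards0.
pose g c (w : n.-tuple 'I_3) : 'I_11 :=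
  inord (radix (is_digit c) w + 5 -
         radix (is_digit c) w0).
have g_inj (c : nat) v w : c \in [:: 1; 2]%N -> v \in A -> w \in A -> g c v = g c w ->
  radix (is_digit c) v =
  radix (is_digit c) w.
  move=> c12 vA wA gvw; have := congr1 (@nat_of_ord 11) gvw; rewrite /g.
  have := near c c12 v w0 vA w0A; have := near c c12 w0 v w0A vA.
  have := near c c12 w w0 wA w0A; have := near c c12 w0 w w0A wA.
  move: (radix _ v) (radix _ w) (radix _ w0) => a b d ? ? ? ?.
  by rewrite !inordK; lia.
have gg_inj : {in A &, injective (fun w => (g 1%N w, g 2%N w))}.
  move=> v w vA wA [/g_inj g1 /g_inj g2].
  by apply: radix_bary_inj; [exact: g1|exact: g2].
rewrite -(card_in_imset gg_inj); apply: leq_trans (max_card _) _.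
by rewrite card_prod !card_ord.
Qed.

Lemma card_le_cover (T : finType) N K (W : {set T}) (A : 'I_N -> {set T}) :
  (forall w, w \in W -> exists i, w \in A i) -> (forall i, #|A i| <= K)%N ->
  (#|W| <= K * N)%N.
Proof.
move=> WA AK; have /subset_leq_card sWA : (W \subset \bigcup_i A i)%SET.
  by apply/fintype.subsetP => w /WA[i wi]; apply/finset.bigcupP; exists i.
apply: leq_trans sWA _; rewrite mulnC -[X in (_ <= X * _)%N](card_ord N).
rewrite -sum_nat_const.
elim/big_ind2 : _ => // [|A1 k1 A2 k2 h1 h2]; first by rewrite cards0.
by apply: leq_trans (leq_card_setU _ _) _; exact: leq_add.
Qed.

Lemma diam_leP (U : set (R * R)) (d : R) :
  (diam U <= d%:E)%E <-> forall x y, U x -> U y -> dist2 x y <= d.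
Proof.
split=> [h x y Ux Uy|h].
  rewrite -lee_fin; apply: le_trans h; apply: ereal_sup_ubound.
  by exists x => //; exists y.
by apply: ge_ereal_sup => _ [x Ux [y Uy <-]]; rewrite lee_fin h.
Qed.

Section slice.
Variables (D : set (R * R)) (y : R).
Hypothesis gasketD : is_gasket D.
Hypothesis y_itv : 0 <= y < (p + q)%N%:R.
Let F := D `&` [set z | height p q z = y].

Lemma slice_nonempty : F !=set0.
Proof.
have [|z Dz zy] := height_surj gasketD (p := p) (q := q) (y := y).
  by case/andP: y_itv => -> /ltW ->.
by exists z.
Qed.

(** The crossing cells themselves form the cover. The condition in [crossing] is half-open, hence
    each point is placed in a cell of which it is not the top. *)
Lemma slice_cover n : exists U : 'I_#|crossing n (Num.floor (y * 2 ^+ n))| ->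
    set (R * R),
  (forall i, (diam (U i) <= (2 * 2 ^- n)%:E)%E) /\ F `<=` \bigcup_i U i.
Proof.
set A := crossing n _.
exists (fun i : 'I_#|A| => [set cell_map (enum_val i) z | z in @triangle R]).
split=> [i|z [Dz zy]].
  apply/diam_leP => _ _ [x tx <-] [x' tx' <-].
  have [h1 h2] := triangle_cell (enum_val i) tx.
  have [h3 h4] := triangle_cell (enum_val i) tx'.
  have n0 : 0 < 2 ^+ n :> R by rewrite exprn_gt0.
  have close (b c s : R) : s <= b * 2 ^+ n <= s + 1 -> s <= c * 2 ^+ n <= s + 1 ->
      `|b - c| <= 2 ^- n.
    move=> h h'; rewrite -[2 ^- n]mul1r ler_pdivlMr //.
    rewrite -(gtr0_norm n0) -normrM mulrBl ler_norml; lra.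
  rewrite !size_tuple in h1 h2 h3 h4.
  by apply: dist2_bary; [exact: close h1 h3|exact: close h2 h4].
have [|w [z' [tz' z't zE]]] := below_top_cell p_gt0 q_gt0 gasketD n Dz.
  by rewrite zy; case/andP: y_itv.
have wc : w \in crossing n (Num.floor (y * 2 ^+ n)).
  rewrite crossing_floor -zy zE (cell_map_affine _ _ (height_map p q)).
  by rewrite size_tuple divfK ?expf_neq0 // addrK height_ge0.
by exists (enum_rank_in wc w) => //; exists z' => //; rewrite enum_rankK_in.
Qed.

(** Every crossing cell contains a point of the slice because [height] maps [D] onto the whole
    range, so it meets some [U i]; and each [U i] meets at most 121 cells. *)
Lemma slice_cover_ge n N (U : 'I_N -> set (R * R)) :
  (forall i, (diam (U i) <= (2 * 2 ^- n)%:E)%E) -> F `<=` \bigcup_i U i ->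
  (#|crossing n (Num.floor (y * 2 ^+ n))| <= 121 * N)%N.
Proof.
move=> dU FU.
pose A i := [set w : n.-tuple 'I_3 |
  `[< exists2 z, @triangle R z & U i (cell_map w z) >]]%SET.
have n0 : 0 < 2 ^+ n :> R by rewrite exprn_gt0.
apply: (@card_le_cover _ _ _ _ A) => [w|i].
  rewrite crossing_floor => /andP[h1 h2].
  have [|z Dz zh] := height_surj gasketD (p := p) (q := q)
      (y := y * 2 ^+ n - (radix (shift p q) w)%:R).
    by rewrite h1 ltW.
  have [|i _ Ui] := FU (cell_map w z).
    split; first exact: cell_map_in.
    rewrite /= (cell_map_affine _ _ (height_map p q)) zh subrK size_tuple.
    by rewrite mulfK // expf_neq0.
  by exists i; rewrite inE; apply/asboolP; exists z => //; exact: gasket_triangle Dz.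
apply: card_nearby => c c12 v w vA wA.
have /asboolP[x tx Ux] : `[< exists2 z, @triangle R z & U i (cell_map v z) >].
  by move: vA; rewrite inE.
have /asboolP[x' tx' Ux'] : `[< exists2 z, @triangle R z & U i (cell_map w z) >].
  by move: wA; rewrite inE.
have dxx := (diam_leP _ _).1 (dU i) _ _ Ux Ux'.
have [h1 h2] := triangle_cell v tx; have [h3 h4] := triangle_cell w tx'.
rewrite !size_tuple in h1 h2 h3 h4.
(* A diameter of [2 * 2 ^- n] moves a barycentric coordinate by at most 4 units of [2 ^- n]; the
   size of a cell adds one more. *)
have close (b b' : R) (s s' : nat) : s%:R <= b * 2 ^+ n <= s%:R + 1 ->
    s'%:R <= b' * 2 ^+ n <= s'%:R + 1 ->
    `|b - b'| <= 2 * dist2 (cell_map v x) (cell_map w x') -> (s <= s' + 5)%N.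
  move=> h h' bb; have : `|b - b'| <= 4 * 2 ^- n by lra.
  rewrite ler_pdivlMr // -(gtr0_norm n0) -normrM mulrBl ler_norml.
  by rewrite -(ler_nat R) natrD; lra.
move: c12; rewrite !inE => /orP[] /eqP->.
  exact: close h1 h3 (bary1_dist _ _).
exact: close h2 h4 (bary2_dist _ _).
Qed.

Lemma card_crossing_gt0 n : (0 < #|crossing n (Num.floor (y * 2 ^+ n))|)%N.
Proof.
have [U [_ FU]] := slice_cover n; have [z /FU[i _ _]] := slice_nonempty.
by case: i => i; exact: leq_ltn_trans.
Qed.

Lemma covering_number_slice n : exists2 c : R,
  covering_number F (2 * 2 ^- n) = c%:E &
  #|crossing n (Num.floor (y * 2 ^+ n))|%:R / 121 <= c <=
  #|crossing n (Num.floor (y * 2 ^+ n))|%:R.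
Proof.
set X := #|_|.
have h1 : (covering_number F (2 * 2 ^- n) <= X%:R%:E)%E.
  apply: ereal_inf_lbound; exists X => //; exact: slice_cover.
have h2 : ((X%:R / 121)%:E <= covering_number F (2 * 2 ^- n))%E.
  apply: le_ereal_inf_tmp => _ [N [U [dU FU]] <-].
  by rewrite lee_fin ler_pdivrMr // mulrC -natrM ler_nat; exact: slice_cover_ge dU FU.
move: h1 h2; case: covering_number => [c| |] //; rewrite !lee_fin => h1 h2.
by exists c => //; rewrite h1 h2.
Qed.

Lemma ln_crossing_cvg d : has_box_dim F d ->
  n%:R^-1 * ln (#|crossing n (Num.floor (y * 2 ^+ n))|%:R : R) @[n --> \oo]
    --> d * ln 2.
Proof.
move=> /fine_cvgP[_ /cvg_at_rightP cvF].
pose x n : R := #|crossing n (Num.floor (y * 2 ^+ n))|%:R.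
have x_gt0 n : 0 < x n by rewrite ltr0n card_crossing_gt0.
have inv0 : (n%:R^-1 : R) @[n --> \oo] --> 0.
  by rewrite -cvg_shiftS; exact: cvg_harmonic.
have d0 : (forall n, 0 < 2 * 2 ^- n :> R) /\ 2 * 2 ^- n @[n --> \oo] --> (0 : R).
  split=> [n|]; first by rewrite mulr_gt0 // invr_gt0 exprn_gt0.
  rewrite -[X in _ --> X](mulr0 2); apply: cvgM; first exact: cvg_cst.
  under eq_fun do rewrite -exprVn.
  by apply: cvg_expr; rewrite ger0_norm ?invr_ge0 // invf_lt1 // ltr1n.
pose c n := fine (covering_number F (2 * 2 ^- n)).
have cE n : covering_number F (2 * 2 ^- n) = (c n)%:E /\ x n / 121 <= c n <= x n.
  by rewrite /c; have [c' -> ?] := covering_number_slice n.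
have c_gt0 n : 0 < c n.
  by have [_ /andP[+ _]] := cE n; apply: lt_le_trans; rewrite divr_gt0.
have {cvF} cvc : ln (c n) / - ln (2 * 2 ^- n) @[n --> \oo] --> d.
  move: (cvF _ d0); apply: cvg_trans; apply: near_eq_cvg; near=> n => /=.
  by rewrite (cE n).1 lne_EFin.
have lnd n : - ln (2 * 2 ^- n) = n%:R * ln 2 - ln 2 :> R.
  rewrite lnM ?posrE ?invr_gt0 ?exprn_gt0 // lnV ?posrE ?exprn_gt0 // lnXn //.
  by rewrite -mulr_natl; lra.
have ln2_gt0 : 0 < ln 2 :> R by rewrite ln_gt0 // ltr1n.
(* The extra factor tends to [ln 2] and equals [(n - 1) ln 2 / n], which turns the denominator
   [(n - 1) ln 2] into [n]. *)
have cv1 : ln (c n) / - ln (2 * 2 ^- n) * (ln 2 - n%:R^-1 * ln 2)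
    @[n --> \oo] --> d * (ln 2 - 0 * ln 2).
  apply: cvgM => //; apply: cvgB; first exact: cvg_cst.
  by apply: cvgM => //; exact: cvg_cst.
(* Replacing the covering number by the number of crossing cells costs at most [ln 121 / n]. *)
have cv2 : n%:R^-1 * (ln (x n) - ln (c n)) @[n --> \oo] --> (0 : R).
  apply: (@squeeze_cvgr _ _ _ _ (cst 0) (fun n => n%:R^-1 * ln 121)).
  - near=> n; have [_ /andP[h1 h2]] := cE n; rewrite /=; apply/andP; split.
      by rewrite mulr_ge0 ?invr_ge0 // subr_ge0 ler_ln ?posrE.
    rewrite ler_wpM2l ?invr_ge0 // -ln_div ?posrE // ler_ln ?posrE ?divr_gt0 //.
    by rewrite ler_pdivrMr // mulrC -ler_pdivrMr.
  - exact: cvg_cst.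
  - by rewrite -(mul0r (ln 121)); apply: cvgM => //; exact: cvg_cst.
have cv3 := @cvgD _ _ _ _ eventually_filter _ _ _ _ cv1 cv2; rewrite mul0r subr0 addr0 in cv3.
apply: (cvg_trans _ cv3).
apply: near_eq_cvg; near=> n; rewrite fctE lnd -/(x n).
have n1 : (1 < n)%N by near: n; exists 2%N.
have n0 : n%:R != 0 :> R by rewrite pnatr_eq0; case: (n) n1.
have n10 : n%:R * ln 2 - ln 2 != 0 :> R.
  by rewrite -[X in _ - X]mul1r -mulrBl mulf_neq0 ?gt_eqF // subr_gt0 ltr1n.
by field; rewrite n10 n0.
Unshelve. all: by end_near. Qed.

End slice.
End crossing.

(** * Convergence in the mean *)

Section dyadic_cells.
Context d (T : measurableType d) (R : realType).
Variables (mu : {measure set T -> \bar R}) (Y : T -> R) (m : nat).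
Hypothesis mY : measurable_fun setT (Y : T -> measurableTypeR R).

(** [Y] will be [height] on the plane with [nu], and an affine function of [a] on the line with
    Lebesgue measure. *)
Definition dyadic_cell n (M : int) : set T := [set t | Num.floor (Y t * 2 ^+ n) = M].
Definition cell_domain : set T := [set t | 0 <= Y t < m%:R].

Lemma measurable_dyadic_cell n M : measurable (dyadic_cell n M).
Proof.
have -> : dyadic_cell n M =
    Y @^-1` (`[M%:~R / 2 ^+ n, (M + 1)%:~R / 2 ^+ n[%classic).
  have n0 : 0 < 2 ^+ n :> R by rewrite exprn_gt0.
  apply/seteqP; split=> t /=; rewrite in_itv /= ler_pdivrMr // ltr_pdivlMr //.
    by move/eqP; rewrite floor_eq.
  by move=> h; apply/eqP; rewrite floor_eq.
by rewrite -[X in measurable X]setTI; apply: mY => //; exact: measurable_itv.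
Qed.

Lemma measurable_cell_domain : measurable cell_domain.
Proof.
have -> : cell_domain = Y @^-1` `[0, m%:R[%classic.
  by apply/seteqP; split=> t /=; rewrite in_itv.
by rewrite -[X in measurable X]setTI; apply: mY => //; exact: measurable_itv.
Qed.

Lemma cell_domain_floor n t : cell_domain t <->
  exists M : 'I_(m * 2 ^ n), dyadic_cell n M%:Z t.
Proof.
have n0 : 0 < 2 ^+ n :> R by rewrite exprn_gt0.
have nE : (m * 2 ^ n)%N%:R = m%:R * 2 ^+ n :> R by rewrite natrM natrX.
split=> [/andP[Y0 Ym]|[M tM]].
  have f0 : 0 <= Num.floor (Y t * 2 ^+ n) by rewrite floor_ge_int mulr_ge0 // ltW.
  have fm : (`|Num.floor (Y t * 2 ^+ n)| < m * 2 ^ n)%N.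
    rewrite -ltz_nat gez0_abs // floor_lt_int.
    by rewrite -[(_ * _)%N%:~R]pmulrn nE ltr_pM2r.
  by exists (Ordinal fm); rewrite /dyadic_cell /= gez0_abs.
move/eqP: tM; rewrite floor_eq => /andP[h1 h2]; apply/andP; split.
  by rewrite -(pmulr_lge0 _ n0); apply: le_trans h1; rewrite ler0z.
rewrite -(ltr_pM2r n0) -nE; apply: lt_le_trans h2 _.
by rewrite pmulrn ler_int; have := ltn_ord M; lia.
Qed.

(** A finite combination of indicators, standing in for [G] composed with the floor so that
    measurability and the integral are immediate. *)
Definition cell_sum n (G : nat -> R) t : R :=
  \sum_(M < m * 2 ^ n) G M * \1_(dyadic_cell n M%:Z) t.

Lemma cell_sumE n G t : cell_domain t ->
  cell_sum n G t = G `|Num.floor (Y t * 2 ^+ n)|%N.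
Proof.
move=> /(cell_domain_floor n)[M tM].
rewrite /cell_sum (bigD1 M) //= indicE mem_set // mulr1 tM absz_nat.
rewrite big1 ?addr0 // => M' M'M; rewrite indicE memNset ?mulr0 //.
by rewrite /dyadic_cell /= tM => -[]/esym/val_inj/eqP; rewrite (negPf M'M).
Qed.

Lemma measurable_cell_sum n G D : measurable_fun D (cell_sum n G).
Proof.
apply: measurable_sum => M; apply: measurable_funM; first exact: measurable_cst.
exact: measurable_indic (measurable_dyadic_cell _ _).
Qed.

Lemma integral_cell_sum n G : (forall M, 0 <= G M) ->
  (\int[mu]_(t in cell_domain) (cell_sum n G t)%:E =
   \sum_(M < m * 2 ^ n) (G M)%:E * mu (dyadic_cell n M%:Z))%E.
Proof.
move=> G0; rewrite /cell_sum.
under eq_integral do rewrite -sumEFin.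
rewrite ge0_integral_sum; first last.
- by move=> M t _; rewrite lee_fin mulr_ge0.
- move=> M; apply/measurable_EFinP; apply: measurable_funM => //.
  exact: measurable_indic (measurable_dyadic_cell _ _).
- exact: measurable_cell_domain.
apply: eq_bigr => M _; under eq_integral do rewrite EFinM.
rewrite ge0_integralZl //; first last.
- by rewrite lee_fin.
- apply/measurable_EFinP; exact: measurable_indic (measurable_dyadic_cell _ _).
- exact: measurable_cell_domain.
rewrite integral_indic; [|exact: measurable_cell_domain|exact: measurable_dyadic_cell].
congr (_ * mu _)%E; apply/setIidl => t tM.
by apply/(cell_domain_floor n); exists M.
Qed.

Hypothesis mu_fin : (mu cell_domain < +oo)%E.

Lemma dyadic_cell_fin n (M : 'I_(m * 2 ^ n)) : mu (dyadic_cell n M%:Z) \is a fin_num.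
Proof.
rewrite ge0_fin_numE //; apply: le_lt_trans mu_fin; apply: le_measure.
- by rewrite inE; exact: measurable_dyadic_cell.
- by rewrite inE; exact: measurable_cell_domain.
- by move=> t tM; apply/(cell_domain_floor n); exists M.
Qed.

Lemma sum_dyadic_cell n :
  (\sum_(M < m * 2 ^ n) mu (dyadic_cell n M%:Z) = mu cell_domain)%E.
Proof.
transitivity (\int[mu]_(t in cell_domain) (cell_sum n (cst 1) t)%:E)%E.
  by rewrite integral_cell_sum //; apply: eq_bigr => M _; rewrite mul1e.
rewrite -[RHS]mul1e -integral_cst; last exact: measurable_cell_domain.
by apply: eq_integral => t; rewrite inE => tD; rewrite cell_sumE.
Qed.

(** Dominated convergence: the sum is the integral of [cell_sum n (G n)], and the constant [C] is
    integrable since the domain has finite mass. *)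
Lemma cell_sum_cvg0 (B : set T) (G : nat -> nat -> R) (C : R) :
  measurable B -> mu B = 0%E -> (forall n M, 0 <= G n M <= C) ->
  (forall t, cell_domain t -> ~ B t ->
    G n `|Num.floor (Y t * 2 ^+ n)|%N @[n --> \oo] --> 0) ->
  \sum_(M < m * 2 ^ n) G n M * fine (mu (dyadic_cell n M%:Z)) @[n --> \oo] --> 0.
Proof.
move=> mB B0 GC Gcvg.
have aeB (P : T -> Prop) : (forall t, ~ B t -> P t) -> {ae mu, forall t, P t}.
  move=> BP; exists B; split=> // t /= Pt; apply: contrapT => Bt; exact/Pt/BP.
have [] := @dominated_convergence _ _ _ mu _ measurable_cell_domain
  (fun n t => (cell_sum n (G n) t)%:E) (cst 0%E) (cst C%:E).
- by move=> n; apply/measurable_EFinP; exact: measurable_cell_sum.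
- exact: measurable_cst.
- apply: aeB => t Bt Dt; apply/fine_cvgP; split; first by near=> n.
  move: (Gcvg t Dt Bt); apply: cvg_trans; apply: near_eq_cvg; near=> n => /=.
  by rewrite cell_sumE.
- apply/integrableP; split; first exact: measurable_cst.
  rewrite (integral_cst _ measurable_cell_domain `|C%:E|%E).
  exact: lte_mul_pinfty.
- apply: aeB => t _ n Dt; rewrite cell_sumE // lee_fin.
  by have /andP[h1 h2] := GC n `|Num.floor (Y t * 2 ^+ n)|%N; rewrite ger0_norm.
move=> _ _; rewrite integral0 => /fine_cvgP[_]; apply: cvg_trans.
apply: near_eq_cvg; near=> n => /=; rewrite integral_cell_sum; last first.
  by move=> M; have /andP[] := GC n M.
rewrite -sum_fine => [|M _]; last by rewrite fin_numM // dyadic_cell_fin.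
by apply: eq_bigr => M _; rewrite fineM // dyadic_cell_fin.
Unshelve. all: by end_near. Qed.

End dyadic_cells.

(** * Crossing counts as entries of the matrix products *)

Section crossing_count.
Variables (R : realType) (p q : nat).
Hypothesis q_gt0 : (0 < q)%N.

Lemma card_crossingE n M : #|crossing p q n M| =
  \sum_(w : n.-tuple 'I_3)
    nat_of_bool (0 <= M - (radix (shift p q) w)%:Z < (p + q)%N%:Z) :> nat.
Proof.
rewrite -sum1_card big_mkcond /=; apply: eq_bigr => w _.
by rewrite inE; case: ifP.
Qed.

(** Words are sorted by their first letter, whose digit contributes [shift p q k * 2 ^ n] to the
    value. *)
Lemma card_crossingS n M : #|crossing p q n.+1 M| =
  \sum_(k < 3) #|crossing p q n (M - (shift p q k * 2 ^ n)%N%:Z)| :> nat.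
Proof.
rewrite card_crossingE.
rewrite (sum_tupleS n (fun w =>
  nat_of_bool (0 <= M - (radix (shift p q) w)%:Z < (p + q)%N%:Z))).
apply: eq_bigr => k _; rewrite card_crossingE; apply: eq_bigr => w _ /=.
by rewrite size_tuple PoszD opprD addrA.
Qed.

Lemma card_crossing_out n M : ~~ (0 <= M < ((p + q) * 2 ^ n)%N%:Z) ->
  #|crossing p q n M| = 0%N.
Proof.
move=> Mout; apply: eq_card0 => w; rewrite inE; apply/negbTE/negP => h.
have := radix_le w (shift_le p q); rewrite size_tuple mulnC.
by move: Mout h; move: (radix _ _) (_ * _)%N => a b; lia.
Qed.

(** At level 0 the empty word crosses exactly the intervals [0 <= M < p + q], so the cascade starts
    from the vector of ones. *)
Lemma crossing_weight n (w : n.-tuple 'I_2) i :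
  (Aword R p q w *m (const_mx 1 : 'cV_(p + q))) i 0 =
  #|crossing p q n (i * 2 ^ n + radix val w)%N%:Z|%:R.
Proof.
rewrite -(@Aword_cascade R p q q_gt0 (fun n M => #|crossing p q n M|%:R)); first last.
- by move=> n' M /card_crossing_out ->.
- by move=> n' M; rewrite card_crossingS natr_sum.
congr ((_ *m _) i 0); apply/matrixP => j z; rewrite !mxE card_crossingE.
by rewrite (sum_tuple0 (fun w =>
  nat_of_bool (0 <= j%:Z - (radix (shift p q) w)%:Z < (p + q)%N%:Z)))
   /= subr0 ltz_nat ltn_ord.
Qed.

Lemma card_crossing_le n M : (#|crossing p q n M| <= 3 ^ n)%N.
Proof. by apply: leq_trans (max_card _) _; rewrite card_tuple card_ord. Qed.

Lemma count_window (K s m : nat) : (\sum_(M < K) nat_of_bool (s <= M < s + m) <= m)%N.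
Proof.
rewrite -(big_mkord xpredT (fun M => nat_of_bool (s <= M < s + m)%N)) /=.
rewrite -big_mkcond /= sum1_count -size_filter -[leqRHS](size_iota s).
apply: uniq_leq_size; first by rewrite filter_uniq // iota_uniq.
by move=> M; rewrite mem_filter mem_iota => /andP[].
Qed.

(** Double counting: each of the [3 ^ n] words crosses at most [p + q] consecutive intervals. *)
Lemma sum_card_crossing n K :
  (\sum_(M < K) #|crossing p q n M%:Z| <= 3 ^ n * (p + q))%N.
Proof.
under eq_bigr do rewrite card_crossingE.
rewrite exchange_big /= -[X in (_ <= X ^ _ * _)%N](card_ord 3) -card_tuple -sum_nat_const.
apply: leq_sum => w _; rewrite -[leqRHS]/((p + q)%N).
apply: leq_trans (count_window K (radix (shift p q) w) _).
apply/leq_sum => M _; apply/eq_leq; congr (nat_of_bool _); lia.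
Qed.

End crossing_count.

(** * Masses of dyadic intervals *)

Section gasket_measure.
Variables (R : realType) (p q : nat).
Hypotheses (p_gt0 : (0 < p)%N) (q_gt0 : (0 < q)%N).
Local Notation plane := (measurableTypeR R * measurableTypeR R)%type.
Variable nu : probability plane R.
Hypothesis gasket_nu : is_gasket_measure nu.

Lemma measurable_height :
  measurable_fun setT (height p q : plane -> measurableTypeR R).
Proof.
have m1 : measurable_fun setT (fst : plane -> measurableTypeR R) by exact: measurable_fst.
have m2 : measurable_fun setT (snd : plane -> measurableTypeR R) by exact: measurable_snd.
rewrite /height /bary1 /bary2.
apply: measurable_funB; [apply: measurable_funD|]; first exact: measurable_cst.
  apply: measurable_funM; first exact: measurable_cst.
  by apply: measurable_funB => //; apply: measurable_funM => //; exact: measurable_cst.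
apply: measurable_funM; first exact: measurable_cst.
apply: measurable_funM; last exact: measurable_cst.
by apply: measurable_funM => //; exact: measurable_cst.
Qed.

Lemma measurable_height_preimage (A : set R) :
  measurable (A : set (measurableTypeR R)) ->
  measurable ([set z | A (height p q z)] : set plane).
Proof.
by move=> mA; rewrite -[X in measurable X]setTI; exact: measurable_height.
Qed.

Lemma gasket_measure_fine (B : set plane) : measurable B ->
  (forall k, measurable (@gasket_map R k @^-1` B : set plane)) ->
  3 * fine (nu B) = \sum_(k < 3) fine (nu (@gasket_map R k @^-1` B)).
Proof.
move=> mB mkB; rewrite gasket_nu // -sum_fine => [|k _]; last first.
  by apply: fin_numM => //; exact: fin_num_measure.
rewrite mulr_sumr; apply: eq_bigr => k _; rewrite fineM ?fin_num_measure //=.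
by rewrite mulrA divff // mul1r.
Qed.

(** Absence of mass outside the range of [height] is drawn from the self-similarity equation. The
    masses [b n] of the nested sets satisfy [3 * b n <= b n.*2 + 2 * b n.*2.+1]; as [b] is
    nonincreasing, this forces [b 0 <= b n] for all [n], while [b n] tends to 0. The map [k0] fixes
    the end of the range beyond which the sets lie. *)
Lemma gasket_measure_null (B : nat -> set R) (k0 : 'I_3) :
  (forall n, measurable (B n : set (measurableTypeR R))) ->
  {homo B : n n' / (n <= n')%N >-> n' `<=` n} ->
  \bigcap_n B n = set0 ->
  (forall n k z, B n ((z + (shift p q k)%:R) / 2) -> B (n.*2 + (k != k0))%N z) ->
  nu [set z | B 0%N (height p q z)] = 0%E.
Proof.
move=> mB Bhomo Bcap Bk.
pose b n := fine (nu [set z | B n (height p q z)]).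
have mh n := measurable_height_preimage (mB n).
have bE n : nu [set z | B n (height p q z)] = (b n)%:E.
  by rewrite fineK // fin_num_measure.
have b_ge0 n : 0 <= b n by rewrite fine_ge0.
have bhomo n n' : (n <= n')%N -> b n' <= b n.
  move=> nn'; rewrite -lee_fin -!bE; apply: le_measure; rewrite ?inE //.
  by move=> z; exact: Bhomo.
have bk n : 3 * b n <= b n.*2 + 2 * b n.*2.+1.
  have preE k : @gasket_map R k @^-1` [set z | B n (height p q z)] =
      [set z | [set y | B n ((y + (shift p q k)%:R) / 2)] (height p q z)].
    by apply/seteqP; split => z /=; rewrite height_map.
  have mk k : measurable (@gasket_map R k @^-1` [set z | B n (height p q z)] : set plane).
    rewrite preE; apply: (measurable_height_preimage (A := [set y | _])).
    rewrite -[X in measurable X]setTI.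
    have mf : measurable_fun setT
        ((fun y => (y + (shift p q k)%:R) / 2) : measurableTypeR R -> measurableTypeR R).
      apply: measurable_funM; last exact: measurable_cst.
      by apply: measurable_funD; [exact: measurable_id|exact: measurable_cst].
    exact: (mf measurableT _ (mB n)).
  rewrite /b gasket_measure_fine // (bigD1 k0) //=.
  have bkle k : fine (nu (@gasket_map R k @^-1` [set z | B n (height p q z)]))
      <= b (n.*2 + (k != k0))%N.
    rewrite -lee_fin -bE fineK ?fin_num_measure //; apply: le_measure; rewrite ?inE //.
    by move=> z /=; rewrite height_map; exact: Bk.
  apply: lerD; first by have := bkle k0; rewrite eqxx addn0.
  apply: (@le_trans _ _ (\sum_(k < 3 | k != k0) b n.*2.+1)).
    by apply: ler_sum => k hk; have := bkle k; rewrite hk addn1.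
  by rewrite sumr_const cardC1 card_ord mulr_natl.
have b_le n : b n <= b n.+1.
  case: n => [|n]; first by have := bk 0%N; rewrite /=; lra.
  apply: le_trans (_ : b n.+1.*2 <= _); last by apply: bhomo; rewrite doubleS; lia.
  have := bk n.+1; have := bhomo n.+1.*2 n.+1.*2.+1 (leqnSn _); lra.
have bcvg : b n @[n --> \oo] --> 0.
  have := @nonincreasing_cvg_mu _ _ _ nu (fun n => [set z | B n (height p q z)]).
  rewrite (_ : \bigcap_n _ = set0); last first.
    apply/seteqP; split => // z Bz; have : (\bigcap_n B n) (height p q z) by [].
    by rewrite Bcap.
  rewrite measure0 => /(_ _ _ _ _)/fine_cvgP[] //.
  - by rewrite -ge0_fin_numE // fin_num_measure.
  - by move=> n n' nn'; apply/subsetPset => z; exact: Bhomo.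
have b0 : b 0%N <= 0.
  have b0n n : b 0%N <= b n by elim: n => // n IH; exact: le_trans (b_le n).
  by apply: (cvgr_to_ge bcvg); near=> n; exact: b0n.
by rewrite bE; congr EFin; apply/eqP; rewrite eq_le b0 b_ge0.
Unshelve. all: by end_near. Qed.

Lemma gasket_measure_low : nu [set z | height p q z < 0] = 0%E.
Proof.
have := @gasket_measure_null (fun n => [set y | y < - n%:R]) (@Ordinal 3 2 isT).
rewrite /= oppr0; apply.
- move=> n; have -> : [set y : R | y < - n%:R] = `]-oo, - n%:R[%classic.
    by apply/seteqP; split => y /=; rewrite in_itv.
  exact: measurable_itv.
- move=> n n' nn' y /=; have : n%:R <= n'%:R :> R by rewrite ler_nat.
  lra.
- apply/seteqP; split => // y /(_ (Num.bound `|y|) I) /=.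
  have := archi_boundP (normr_ge0 y); have := ler_norm (- y); rewrite normrN; lra.
- move=> n k y /=; rewrite natrD -muln2 natrM.
  have q1 : 1 <= q%:R :> R by rewrite ler1n.
  by case: k => -[|[|[|//]]] h /=; rewrite /shift /= ?natrD; have := ler0n R p; lra.
Qed.

(** The first half-line is closed: the top value [p + q] must be null as well, since the cells are
    half-open. *)
Lemma gasket_measure_high : nu [set z | (p + q)%N%:R <= height p q z] = 0%E.
Proof.
have := @gasket_measure_null (fun n => [set y | (p + q + n)%N%:R <= y]) (@Ordinal 3 1 isT).
rewrite /= addn0; apply.
- move=> n; have -> : [set y : R | (p + q + n)%N%:R <= y] = `[(p + q + n)%N%:R, +oo[%classic.
    by apply/seteqP; split => y /=; rewrite in_itv /= andbT.
  exact: measurable_itv.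
- move=> n n' nn' y /=; apply: le_trans; by rewrite ler_nat leq_add2l.
- apply/seteqP; split => // y /(_ (Num.bound `|y|) I) /=; rewrite natrD.
  have := archi_boundP (normr_ge0 y); have := ler_norm y.
  have := ler0n R (p + q); lra.
- move=> n k y /=; rewrite !natrD -muln2 natrM.
  have q1 : 1 <= q%:R :> R by rewrite ler1n.
  have p1 : 1 <= p%:R :> R by rewrite ler1n.
  by case: k => -[|[|[|//]]] h /=; rewrite /shift /= ?natrD; lra.
Qed.

Lemma gasket_measure_domain : nu (cell_domain (height p q) (p + q)) = 1%E.
Proof.
have mD := measurable_cell_domain (p + q) measurable_height.
have mC := measurableC mD.
have mlow : measurable ([set z | height p q z < 0] : set plane).
  apply: (measurable_height_preimage (A := [set y | y < 0])).
  have -> : [set y : R | y < 0] = `]-oo, 0[%classic.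
    by apply/seteqP; split => y /=; rewrite in_itv.
  exact: measurable_itv.
have mhigh : measurable ([set z | (p + q)%N%:R <= height p q z] : set plane).
  apply: (measurable_height_preimage (A := [set y | _ <= y])).
  have -> : [set y : R | (p + q)%N%:R <= y] = `[(p + q)%N%:R, +oo[%classic.
    by apply/seteqP; split => y /=; rewrite in_itv /= andbT.
  exact: measurable_itv.
have : nu (~` cell_domain (height p q) (p + q)) = 0%E.
  apply: (@subset_measure0 _ _ _ nu _
    ([set z | height p q z < 0] `|` [set z | (p + q)%N%:R <= height p q z])) => //.
  - exact: measurableU.
  - move=> z; rewrite /cell_domain /=; move/negP; rewrite negb_and -ltNge -leNgt.
    by case/orP; [left|right].
  - exact: etrans (measureU0 mlow mhigh gasket_measure_high) gasket_measure_low.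
rewrite probability_setC // => /eqP; rewrite sube_eq ?add0e //.
  by move/eqP.
Qed.

Definition nu_cell n M : R := fine (nu (dyadic_cell (height p q) n M)).

Let mcell n M := measurable_dyadic_cell measurable_height n M.

Lemma nu_cellS n M : 3 * nu_cell n.+1 M =
  \sum_(k < 3) nu_cell n (M - (shift p q k * 2 ^ n)%N%:Z).
Proof.
have E k : @gasket_map R k @^-1` dyadic_cell (height p q) n.+1 M =
    dyadic_cell (height p q) n (M - (shift p q k * 2 ^ n)%N%:Z).
  have hE z : height p q (gasket_map k z) * 2 ^+ n.+1 =
      height p q z * 2 ^+ n + (shift p q k * 2 ^ n)%N%:Z%:~R.
    by rewrite height_map exprS -pmulrn natrM natrX; field.
  apply/seteqP; split => z; rewrite /dyadic_cell /= hE floorDrz ?intr_int // intrKfloor.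
    by move=> <-; rewrite addrK.
  by move=> ->; rewrite subrK.
rewrite /nu_cell (gasket_measure_fine (mcell _ _)) => [|k]; last by rewrite E; exact: mcell.
by apply: eq_bigr => k _; rewrite E.
Qed.

Lemma nu_cell_out n M : ~~ (0 <= M < ((p + q) * 2 ^ n)%N%:Z) -> nu_cell n M = 0.
Proof.
move=> Mout; rewrite /nu_cell.
have sub (A : set plane) : measurable A -> nu A = 0%E ->
    dyadic_cell (height p q) n M `<=` A -> fine (nu (dyadic_cell (height p q) n M)) = 0.
  by move=> mA A0 sA; rewrite (subset_measure0 (mcell n M) mA sA A0).
have mD := measurable_cell_domain (p + q) measurable_height.
apply: (sub (~` cell_domain (height p q) (p + q))).
- exact: measurableC.
- by rewrite probability_setC // gasket_measure_domain subee.
move=> z zM /(cell_domain_floor _ _ n)[M']; rewrite /dyadic_cell /= in zM *.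
by rewrite zM => ME; move: Mout; rewrite ME /= ltz_nat ltn_ord.
Qed.

Definition pvec : 'cV[R]_(p + q) := \col_j nu_cell 0 j%:Z.

Lemma nu_cell_weight n (w : n.-tuple 'I_2) i :
  (Aword R p q w *m pvec) i 0 = 3 ^+ n * nu_cell n (i * 2 ^ n + radix val w)%N%:Z.
Proof.
rewrite -(@Aword_cascade R p q q_gt0 (fun n M => 3 ^+ n * nu_cell n M)); first last.
- by move=> n' M /nu_cell_out ->; rewrite mulr0.
- by move=> n' M; rewrite exprSr -mulrA nu_cellS mulr_sumr.
by congr ((_ *m _) i 0); apply/matrixP => j z; rewrite !mxE expr0 mul1r.
Qed.

Lemma sum_nu_cell n : \sum_(M < (p + q) * 2 ^ n) nu_cell n M%:Z = 1.
Proof.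
rewrite sum_fine => [|M _]; last exact: (fin_num_measure nu _ (mcell n M)).
by rewrite (etrans (sum_dyadic_cell nu (p + q) measurable_height n) gasket_measure_domain).
Qed.

Lemma nu_cell_split i : nu_cell 0 i%:Z = nu_cell 1 (i * 2)%N%:Z + nu_cell 1 (i * 2 + 1)%N%:Z.
Proof.
have fin n M := fin_num_measure nu _ (mcell n M).
have disj : dyadic_cell (@height R p q) 1 (i * 2)%N%:Z `&`
    dyadic_cell (@height R p q) 1 (i * 2 + 1)%N%:Z = set0.
  by rewrite -subset0 => z [] /=; rewrite /dyadic_cell /= => -> []; lia.
rewrite /nu_cell -(fineD (fin 1%N _) (fin 1%N _)).
apply: (etrans _ (congr1 fine (measureU nu (mcell _ _) (mcell _ _) disj))).
congr (fine (nu _)); apply/seteqP; split => z; rewrite /dyadic_cell /= expr0 expr1 mulr1.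
  move/eqP; rewrite floor_eq => /andP[h1 h2].
  have [h|h] := ltP (height p q z * 2) (i * 2 + 1)%N%:R; [left|right];
    apply/eqP; rewrite floor_eq; apply/andP; split;
    move: h1 h2 h; rewrite ?intrD -?pmulrn ?natrD ?natrM; lra.
by case=> /eqP; rewrite !floor_eq => /andP[h1 h2]; apply/eqP; rewrite floor_eq;
  apply/andP; split; move: h1 h2; rewrite ?intrD -?pmulrn ?natrD ?natrM; lra.
Qed.

(** Entry [i] of [A_x pvec] is three times the mass of one half of the unit interval [i], and the
    two halves add up to the whole. *)
Lemma is_pvec_pvec : is_pvec pvec.
Proof.
split; first split.
- by move=> i; rewrite mxE fine_ge0.
- rewrite -[RHS](sum_nu_cell 0) expn0 muln1.
  by apply: eq_bigr => i _; rewrite mxE.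
apply/matrixP => i z; rewrite (ord1 z) mulmxDl mxE.
have A1 (x : 'I_2) : (Amx R p q x *m pvec) i 0 = 3 * nu_cell 1 (i * 2 + x)%N%:Z.
  have := nu_cell_weight [tuple x] i.
  by rewrite /Aword big_cons big_nil mulmx1 /= expr1 expn1 expn0 muln1 addn0.
by rewrite !A1 -mulrDr !mxE nu_cell_split addn0.
Qed.

End gasket_measure.

(** * Uniqueness of the probability eigenvector *)

Section perron_vector.
Variables (R : realType) (p q : nat).
Hypothesis q_gt0 : (0 < q)%N.
Let A : 'M[R]_(p + q) := Amx R p q ord0 + Amx R p q ord_max.

Let AE i j : A i j = \sum_(k < 3) ((j + shift p q k == i * 2)%N%:R +
  (j + shift p q k == i * 2 + 1)%N%:R).
Proof. by rewrite mxE !AmxE // -big_split /=; apply: eq_bigr => k _; rewrite addn0. Qed.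

Let A_ge0 i j : 0 <= A i j.
Proof. by rewrite AE; apply: sumr_ge0 => k _; rewrite addr_ge0. Qed.

(** For each of the three [k], the number [j + shift p q k] is [2 i] or [2 i + 1] for exactly one
    row [i], its half. *)
Lemma Amx_col_sum j : \sum_i A i j = 3.
Proof.
under eq_bigr do rewrite AE; rewrite exchange_big /=.
rewrite (eq_bigr (fun=> 1)) => [|k _]; first by rewrite sumr_const card_ord.
have := leq_add (ltn_ord j) (shift_le p q k); rewrite addSn.
move: (j + shift p q k)%N => t tm.
have t2 : (t./2 < p + q)%N by rewrite ltn_half_double; lia.
rewrite (bigD1 (Ordinal t2)) //= big1 => [|i]; last first.
  rewrite -val_eqE /= => ti; have te := odd_double_half t.
  by do 2!(case: eqP => [?|_]; first (by lia)); rewrite addr0.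
rewrite addr0 -{1 3}(odd_double_half t) -muln2 addnC eqn_add2l.
by rewrite -[X in _ == X]addn0 eqn_add2l; case: odd; rewrite ?addr0 ?add0r.
Qed.

(* Every state is driven to the state 0 by [j |-> j / 2]. *)
Lemma Amx_eigen_eq0 (e : 'I_(p + q) -> R) (i0 : 'I_(p + q)) :
  (forall i, 0 <= e i) -> (forall i, 3 * e i = \sum_j A i j * e j) ->
  i0 = 0%N :> nat -> e i0 = 0 -> forall j, e j = 0.
Proof.
move=> e0 eE i00 ei0 [j jm]; elim/ltn_ind: j jm => -[|j] IH jm.
  by rewrite -ei0; congr e; apply: val_inj.
have j2 : (j.+1./2 < j.+1)%N by rewrite ltn_half_double; lia.
have j2m := ltn_trans j2 jm.
have := eE (Ordinal j2m); rewrite IH // mulr0 => /esym/eqP.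
rewrite psumr_eq0 => [|j' _]; last by rewrite mulr_ge0.
move=> /allP/(_ (Ordinal jm)); rewrite mem_index_enum => /(_ isT) /=.
rewrite mulf_eq0 => /orP[|/eqP//]; rewrite AE => /eqP h; exfalso; move: h.
(* The entry in row [j.+1./2] and column [j.+1] is positive thanks to the letter of shift 0; the
   parity of [j.+1] tells which of the two matrices contributes. *)
apply/eqP; rewrite gt_eqF // (bigD1 (@Ordinal 3 2 isT)) //=.
apply: ltr_wpDr; first by apply: sumr_ge0 => k _; rewrite addr_ge0.
rewrite /shift /= addn0; have := odd_double_half j.+1.
case: odd => [h|h].
  by apply: ltr_wpDl => //; rewrite (_ : _ == _) // -{1}h; apply/eqP; lia.
by apply: ltr_pwDl => //; rewrite (_ : _ == _) // -{1}h; apply/eqP; lia.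
Qed.

(** A Perron argument on the difference [d]. Since columns sum to 3, the inequalities
    [3 |d| <= A |d|] are equalities, so [|d| + d] and [|d| - d] are nonnegative eigenvectors. One of
    them vanishes at the state 0, hence everywhere; then [d] has constant sign, and its sum is
    zero. *)
Lemma pvec_unique (v w : 'cV[R]_(p + q)) : is_pvec v -> is_pvec w -> v = w.
Proof.
move=> [[v0 v1] vE] [[w0 w1] wE].
pose d i := v i 0 - w i 0.
have dE i : 3 * d i = \sum_j A i j * d j.
  under eq_bigr do rewrite mulrBr; rewrite sumrB mulrBr.
  by have := congr1 (fun u : 'cV_(p + q) => u i 0) vE;
     have := congr1 (fun u : 'cV_(p + q) => u i 0) wE; rewrite !mxE => <- <-.
have dsum : \sum_i d i = 0 by rewrite sumrB v1 w1 subrr.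
have absE i : 3 * `|d i| = \sum_j A i j * `|d j|.
  have le k : 3 * `|d k| <= \sum_j A k j * `|d j|.
    rewrite -[3]ger0_norm // -normrM dE; apply: le_trans (ler_norm_sum _ _ _) _.
    by apply: ler_sum => j _; rewrite normrM ger0_norm.
  have : \sum_k (\sum_j A k j * `|d j| - 3 * `|d k|) == 0.
    rewrite sumrB exchange_big /= -sumrB big1 // => j _.
    by rewrite -mulr_suml Amx_col_sum subrr.
  rewrite psumr_eq0 => [|k _]; last by rewrite subr_ge0.
  move=> /allP/(_ i); rewrite mem_index_enum => /(_ isT) /=.
  by rewrite subr_eq0 => /eqP.
have m0 : (0 < p + q)%N by rewrite addn_gt0 q_gt0 orbT.
pose i0 := Ordinal m0.
have posE i : 3 * (`|d i| + d i) = \sum_j A i j * (`|d j| + d j).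
  by under eq_bigr do rewrite mulrDr; rewrite big_split /= -absE -dE mulrDr.
have negE i : 3 * (`|d i| - d i) = \sum_j A i j * (`|d j| - d j).
  by under eq_bigr do rewrite mulrBr; rewrite sumrB /= -absE -dE mulrBr.
have pos0 i : 0 <= `|d i| + d i by have := ler_norm (- d i); rewrite normrN; lra.
have neg0 i : 0 <= `|d i| - d i by have := ler_norm (d i); lra.
have abs0 : \sum_i `|d i| = 0.
  have [dp|dn] := leP 0 (d i0).
    have h := Amx_eigen_eq0 neg0 negE (erefl : i0 = 0%N :> nat).
    apply: etrans dsum; apply: eq_bigr => i _; apply/eqP; rewrite -subr_eq0; apply/eqP.
    by apply: h; rewrite ger0_norm ?subrr.
  have h := Amx_eigen_eq0 pos0 posE (erefl : i0 = 0%N :> nat).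
  apply: oppr_inj; rewrite oppr0 -sumrN; apply: etrans dsum.
  apply: eq_bigr => i _; apply/eqP.
  by rewrite eq_sym -subr_eq0 opprK addrC; apply/eqP/h; rewrite ltr0_norm // addNr.
apply/matrixP => i z; rewrite (ord1 z); apply/eqP; rewrite -subr_eq0 -normr_eq0.
move/eqP: abs0; rewrite psumr_eq0 // => /allP/(_ i); apply.
exact: mem_index_enum.
Qed.

End perron_vector.

(** * The two limits *)

Section limits.
Variable R : realType.

Lemma cvg_dist_le (u b : nat -> R) c : (forall n, `|u n - c| <= b n) ->
  b n @[n --> \oo] --> 0 -> u n @[n --> \oo] --> c.
Proof.
move=> ub b0; apply/cvgrPdist_le => e e0.
have /cvgr0_norm_le/(_ _ e0) := b0; apply: filterS => n.
by apply: le_trans; rewrite distrC; apply: le_trans (ub n) (ler_norm _).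
Qed.

Lemma cvg_invn (a : R) : n%:R^-1 * a @[n --> \oo] --> 0.
Proof.
rewrite -(mul0r a); apply: cvgM; last exact: cvg_cst.
by rewrite -cvg_shiftS; exact: cvg_harmonic.
Qed.

Lemma ln_nat_ge0 n : 0 <= ln n%:R :> R.
Proof.
by case: n => [|n]; [rewrite ln0|rewrite ln_ge0 // ler1n].
Qed.

(* For [x = 0] the convention [ln 0 = 0] is used. *)
Lemma ln_sum_dist m n (x : 'I_m -> nat) (c : R) : (0 < m)%N ->
  `|n%:R^-1 * ln (\sum_i (x i)%:R) - c| <=
  n%:R^-1 * ln m%:R + \sum_i `|n%:R^-1 * ln (x i)%:R - c|.
Proof.
move=> m0; have n0 : 0 <= n%:R^-1 :> R by rewrite invr_ge0.
(* The largest entry controls both sides: it is at most the sum, which is at most [m] times it. *)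
case: (@arg_maxnP _ (Ordinal m0) xpredT x isT) => i _ xi.
have {}xi j : (x j <= x i)%N by exact: xi.
have lower : ln (x i)%:R <= ln (\sum_i (x i)%:R) :> R.
  have [->|xi0] := posnP (x i); first by rewrite ln0 // -natr_sum ln_nat_ge0.
  have h : (x i)%:R <= \sum_i (x i)%:R :> R.
    by rewrite -natr_sum ler_nat (bigD1 i) //= leq_addr.
  have x0 : 0 < (x i)%:R :> R by rewrite ltr0n.
  by rewrite ler_ln ?posrE // (lt_le_trans x0).
have upper : ln (\sum_i (x i)%:R) <= ln m%:R + ln (x i)%:R :> R.
  have [xi0|xi0] := posnP (x i).
    rewrite big1 => [|j _]; first by rewrite ln0 // addr_ge0 ?ln_nat_ge0.
    by have := xi j; rewrite xi0 leqn0 => /eqP ->.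
  have h : \sum_i (x i)%:R <= m%:R * (x i)%:R :> R.
    rewrite -natr_sum -natrM ler_nat -[X in (_ <= X * _)%N]card_ord -sum_nat_const.
    by apply: leq_sum => j _.
  rewrite -lnM ?posrE ?ltr0n // ler_ln ?posrE ?mulr_gt0 ?ltr0n //.
  apply: lt_le_trans (_ : (x i)%:R <= _); first by rewrite ltr0n.
  by rewrite -natr_sum ler_nat (bigD1 i) //= leq_addr.
rewrite [X in _ <= _ + X](bigD1 i) //=.
have : 0 <= \sum_(j < m | j != i) `|n%:R^-1 * ln (x j)%:R - c|.
  by apply: sumr_ge0.
have := mulr_ge0 n0 (ln_nat_ge0 m).
have := ler_wpM2l n0 lower; have := ler_wpM2l n0 upper; rewrite mulrDr.
have := ler_norm (n%:R^-1 * ln (x i)%:R - c).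
have := ler_norm (- (n%:R^-1 * ln (x i)%:R - c)); rewrite normrN.
move=> *; rewrite ler_norml; lra.
Qed.

(* Here [ln t <= t] bounds the entropy-like difference between weighting the
   logarithm of [x] and that of [z]. *)
Lemma mul_ln_dist (x y z : R) : 0 <= y -> y <= x -> y <= z ->
  `|y * ln x - y * ln z| <= x + z.
Proof.
rewrite le_eqVlt => /predU1P[<- x0 z0|y0 yx yz].
  by rewrite !mul0r subrr normr0 addr_ge0.
have x0 := lt_le_trans y0 yx; have z0 := lt_le_trans y0 yz.
have half (a b : R) : 0 < a -> 0 < b -> y <= b -> y * ln a - y * ln b <= a.
  move=> a0 b0 yb; rewrite -mulrBr -ln_div ?posrE //.
  apply: (@le_trans _ _ (y * (a / b))).
    by rewrite ler_wpM2l ?ltW // ln_sublinear // divr_gt0.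
  by rewrite mulrCA ger_pMr // ler_pdivrMr // mul1r.
rewrite ler_norml; apply/andP; split; last first.
  by apply: le_trans (half x z x0 z0 yz) _; rewrite lerDl ltW.
rewrite lerNl opprB; apply: le_trans (half z x z0 x0 yx) _.
by rewrite lerDr ltW.
Qed.

End limits.

Section limit_formulas.
Variables (R : realType) (p q : nat).
Hypothesis q_gt0 : (0 < q)%N.
Let m_gt0 : (0 < p + q)%N. Proof. by rewrite addn_gt0 q_gt0 orbT. Qed.

Let cross n (w : n.-tuple 'I_2) (i : 'I_(p + q)) : nat :=
  #|crossing p q n (i * 2 ^ n + radix val w)%N%:Z|.

Lemma word_weightE n (w : n.-tuple 'I_2) (v : 'cV[R]_(p + q)) :
  word_weight w v = \sum_i (Aword R p q w *m v) i 0.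
Proof.
by rewrite /word_weight -mulmxA mxE; apply: eq_bigr => i _; rewrite mxE mul1r.
Qed.

(** For each word, [ln_sum_dist] compares the logarithm of the sum of entries with those of the
    entries; averaging over the [2 ^ n] words leaves the mean error of the hypothesis and a term
    [O(1/n)]. *)
Lemma alpha_seq_cvg c :
  \sum_(M < (p + q) * 2 ^ n)
    `|n%:R^-1 * ln #|crossing p q n M%:Z|%:R - c| * 2 ^- n @[n --> \oo] --> 0 ->
  alpha_seq R p q n @[n --> \oo] --> c.
Proof.
move=> L1; apply: (@cvg_dist_le _ _ (fun n => n%:R^-1 * ln (p + q)%N%:R +
  \sum_(M < (p + q) * 2 ^ n)
    `|n%:R^-1 * ln #|crossing p q n M%:Z|%:R - c| * 2 ^- n)); last first.
  by rewrite -[X in _ --> X]addr0; apply: cvgD => //; exact: cvg_invn.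
move=> n; have mean (a : R) : a = \sum_(w : n.-tuple 'I_2) 2 ^- n * a.
  rewrite -mulr_suml -[LHS]mul1r; congr (_ * _).
  rewrite sumr_const card_tuple card_ord -[_ *+ _]mulr_natl natrX divff //.
rewrite -(sum_cells _ _ (fun M => `|n%:R^-1 * ln #|crossing p q n M%:Z|%:R - c| * 2 ^- n)).
rewrite exchange_big /=.
rewrite [X in _ <= X + _]mean -big_split /= /alpha_seq mulr_sumr [X in _ - X]mean -sumrB.
apply: le_trans (ler_norm_sum _ _ _) _; apply: ler_sum => w _.
rewrite -mulr_suml [X in _ <= _ + X]mulrC -mulrDr.
rewrite [X in X - _]mulrCA -mulrBr normrM.
rewrite [X in X * _ <= _]ger0_norm ?invr_ge0 ?exprn_ge0 //.
rewrite ler_wpM2l ?invr_ge0 ?exprn_ge0 // word_weightE.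
under eq_bigr => i _ do rewrite crossing_weight //.
exact: (@ln_sum_dist _ _ n (cross w) c m_gt0).
Qed.

Lemma Aword_ge0 n (w : n.-tuple 'I_2) i j : 0 <= Aword R p q w i j.
Proof.
elim: n w i j => [|n IH] w i j.
  by rewrite tuple0 /Aword big_nil mxE ler0n.
case/tupleP: w => x w; rewrite AwordS mxE; apply: sumr_ge0 => k _.
by rewrite mulr_ge0 // AmxE // sumr_ge0.
Qed.

(** With [x] the count, [y] the scaled mass and [z] the sum of [y] over rows, [z ln z] is the sum of
    the [y ln z]. Replacing [ln z] by [ln x] costs at most [x + z] by [mul_ln_dist], and the total
    of that, weighted by [3 ^- n], stays bounded. *)
Lemma beta_seq_cvg (v : 'cV[R]_(p + q)) (W : nat -> nat -> R) c :
  is_prob_vec v ->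
  (forall n (w : n.-tuple 'I_2) i,
    (Aword R p q w *m v) i 0 = 3 ^+ n * W n (i * 2 ^ n + radix val w)%N) ->
  (forall n, \sum_(M < (p + q) * 2 ^ n) W n M = 1) ->
  \sum_(M < (p + q) * 2 ^ n)
    `|n%:R^-1 * ln #|crossing p q n M%:Z|%:R - c| * W n M @[n --> \oo] --> 0 ->
  beta_seq v n @[n --> \oo] --> c.
Proof.
move=> [v0 v1] vW W1 L1.
apply: (@cvg_dist_le _ _ (fun n => n%:R^-1 * ((p + q)%N%:R + (p + q)%N%:R) +
  \sum_(M < (p + q) * 2 ^ n)
    `|n%:R^-1 * ln #|crossing p q n M%:Z|%:R - c| * W n M)); last first.
  by rewrite -[X in _ --> X]addr0; apply: cvgD => //; exact: cvg_invn.
move=> n; pose x (w : n.-tuple 'I_2) i : R := (cross w i)%:R.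
pose y (w : n.-tuple 'I_2) i := (Aword R p q w *m v) i 0.
pose z (w : n.-tuple 'I_2) := \sum_i y w i.
have y_ge0 w i : 0 <= y w i.
  by rewrite /y mxE; apply: sumr_ge0 => j _; rewrite mulr_ge0 // Aword_ge0.
(* The entries of a probability vector are at most 1, and those of the matrices are nonnegative. *)
have y_le_x w i : y w i <= x w i.
  rewrite /x /cross -crossing_weight // /y !mxE; apply: ler_sum => j _.
  rewrite ler_wpM2l ?Aword_ge0 // mxE -v1 (bigD1 j) //= lerDl.
  exact: sumr_ge0.
have y_le_z w i : y w i <= z w by rewrite /z (bigD1 i) //= lerDl; exact: sumr_ge0.
have yW w i : 3 ^- n * y w i = W n (i * 2 ^ n + radix val w)%N.
  by rewrite /y vW mulKf // expf_neq0 // pnatr_eq0.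
have sum_y : \sum_(w : n.-tuple 'I_2) \sum_i 3 ^- n * y w i = 1.
  rewrite exchange_big /=; apply: etrans (W1 n); rewrite -(sum_cells _ _ (W n)).
  by apply: eq_bigr => i _; apply: eq_bigr => w _; exact: yW.
have sum_x : \sum_(w : n.-tuple 'I_2) \sum_i 3 ^- n * x w i <= (p + q)%N%:R.
  rewrite exchange_big /=.
  rewrite (sum_cells _ _ (fun M => 3 ^- n * #|crossing p q n M%:Z|%:R)).
  rewrite -mulr_sumr -natr_sum ler_pdivrMl ?exprn_gt0 // -natrX -natrM ler_nat.
  exact: sum_card_crossing.
have sum_z : \sum_(w : n.-tuple 'I_2) \sum_(i < p + q) 3 ^- n * z w = (p + q)%N%:R.
  rewrite exchange_big /= (eq_bigr (fun=> 1)) => [|i _].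
    by rewrite sumr_const card_ord.
  by apply: etrans sum_y; apply: eq_bigr => w _; rewrite /z mulr_sumr.
rewrite -(sum_cells _ _
  (fun M => `|n%:R^-1 * ln #|crossing p q n M%:Z|%:R - c| * W n M)).
have -> : beta_seq v n - c =
  n%:R^-1 * (\sum_(w : n.-tuple 'I_2) \sum_i 3 ^- n * (y w i * ln (z w) - y w i * ln (x w i))) +
  \sum_(w : n.-tuple 'I_2) \sum_i (n%:R^-1 * ln (x w i) - c) * (3 ^- n * y w i).
  rewrite -[X in _ - X]mulr1 -[X in _ - _ * X]sum_y /beta_seq !mulr_sumr -sumrB -big_split /=.
  apply: eq_bigr => w _; rewrite word_weightE -/(z w) {1}/z mulr_suml !mulr_sumr.
  rewrite -sumrB -big_split /=; apply: eq_bigr => i _; rewrite -/(y w i).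
  by rewrite -/(z w); ring.
apply: le_trans (ler_normD _ _) _; apply: lerD; last first.
  rewrite exchange_big /=; apply: le_trans (ler_norm_sum _ _ _) _.
  apply: ler_sum => i _; apply: le_trans (ler_norm_sum _ _ _) _; apply: ler_sum => w _.
  by rewrite -yW normrM [X in _ * X <= _]ger0_norm // mulr_ge0 ?invr_ge0 ?exprn_ge0.
rewrite normrM [X in X * _ <= _]ger0_norm ?invr_ge0 // ler_wpM2l ?invr_ge0 //.
apply: (@le_trans _ _ (\sum_(w : n.-tuple 'I_2) \sum_i
    (3 ^- n * z w + 3 ^- n * x w i))); last first.
  by under eq_bigr do rewrite big_split; rewrite big_split /= sum_z lerD2l.
apply: le_trans (ler_norm_sum _ _ _) _; apply: ler_sum => w _.
apply: le_trans (ler_norm_sum _ _ _) _; apply: ler_sum => i _.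
rewrite -mulrDr normrM [X in X * _ <= _]ger0_norm ?invr_ge0 ?exprn_ge0 //.
by rewrite ler_wpM2l ?invr_ge0 ?exprn_ge0 // mul_ln_dist.
Qed.

End limit_formulas.

(** * Slices as level sets of the height *)

Section slice_counting.
Variables (R : realType) (p q : nat) (theta : R) (D : set (R * R)).
Hypotheses (p_gt0 : (0 < p)%N) (q_gt0 : (0 < q)%N) (gasketD : is_gasket D).
Hypothesis tan_theta : tan theta = Num.sqrt 3 * p%:R / (2 * q%:R + p%:R).

(** This is [p / tan theta], the factor between [proj_angle theta] and [height]. *)
Definition slope : R := (2 * q%:R + p%:R) / Num.sqrt 3.

Lemma slope_gt0 : 0 < slope.
Proof.
by rewrite divr_gt0 ?sqrtr_gt0 // ltr_wpDr // mulr_gt0 // ltr0n.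
Qed.

Lemma height_proj z : height p q z = q%:R - slope * proj_angle theta z.
Proof.
have s0 : Num.sqrt 3 != 0 :> R by rewrite gt_eqF // sqrtr_gt0.
have d0 : 2 * q%:R + p%:R != 0 :> R.
  by rewrite gt_eqF // ltr_wpDr // mulr_gt0 // ltr0n.
rewrite /height /bary1 /bary2 /proj_angle /slope tan_theta; field.
by rewrite d0 s0.
Qed.

Lemma sliceE a : slice D theta a = D `&` [set z | height p q z = q%:R - slope * a].
Proof.
have := slope_gt0 => s0; apply/seteqP; split=> z.
  by case=> -[x _ <-] Dz; split=> //=; rewrite height_proj /proj_angle /= addrK.
case=> Dz /=; rewrite height_proj => /addrI/oppr_inj/(mulfI (lt0r_neq0 s0)) za.
split=> //; exists z.1 => //; rewrite -za /proj_angle subrK.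
by rewrite -surjective_pairing.
Qed.

(** Box dimension gives convergence of the normalised logarithms off the null set [B]; they are
    bounded by [ln 3] because there are only [3 ^ n] words. *)
Lemma crossing_L1 d (T : measurableType d) (mu : {measure set T -> \bar R})
    (Y : T -> R) (B : set T) (dim : R) :
  measurable_fun setT (Y : T -> measurableTypeR R) ->
  (mu (cell_domain Y (p + q)) < +oo)%E ->
  measurable B -> mu B = 0%E ->
  (forall t, ~ B t -> 0 <= Y t < (p + q)%N%:R ->
    has_box_dim (D `&` [set z | height p q z = Y t]) dim) ->
  \sum_(M < (p + q) * 2 ^ n)
    `|n%:R^-1 * ln #|crossing p q n M%:Z|%:R - dim * ln 2| *
      fine (mu (dyadic_cell Y n M%:Z)) @[n --> \oo] --> 0.
Proof.
move=> mY muD mB B0 Ydim.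
apply: (@cell_sum_cvg0 _ _ _ mu Y (p + q) mY muD B
  (fun n M => `|n%:R^-1 * ln #|crossing p q n M%:Z|%:R - dim * ln 2|)
  (ln 3 + `|dim * ln 2|)) => // [n M|t Dt Bt].
  rewrite normr_ge0 /=; apply: le_trans (ler_normB _ _) _; rewrite lerD2r.
  rewrite ger0_norm ?mulr_ge0 ?invr_ge0 ?ln_nat_ge0 //.
  have [->|n0] := posnP n; first by rewrite invr0 mul0r ln_ge0 // ler1n.
  rewrite mulrC ler_pdivrMr ?ltr0n // mulr_natr -lnXn //.
  have [->|X0] := posnP #|crossing p q n M%:Z|.
    by rewrite ln0 // -natrX ln_nat_ge0.
  by rewrite ler_ln ?posrE ?ltr0n ?exprn_gt0 // -natrX ler_nat card_crossing_le.
have := ln_crossing_cvg p_gt0 q_gt0 gasketD Dt (Ydim t Bt Dt).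
move=> /cvgB/(_ (cvg_cst (dim * ln 2)))/cvg_norm; rewrite subrr normr0.
apply: cvg_trans; apply: near_eq_cvg; near=> n => /=.
rewrite gez0_abs // floor_ge_int.
by apply: mulr_ge0; [case/andP: Dt|exact: exprn_ge0].
Unshelve. all: by end_near. Qed.

(** By surjectivity of [height], every [a] with [q - slope * a] in the range lies in the projection
    of [D], so the almost-everywhere statement applies to it. *)
Lemma ae_slice_box_dim (mu : set (measurableTypeR R) -> \bar R) dim :
  ae_slice_dim mu D theta dim ->
  exists B, [/\ measurable B, mu B = 0%E & forall a, ~ B a ->
    0 <= q%:R - slope * a < (p + q)%N%:R ->
    has_box_dim (D `&` [set z | height p q z = q%:R - slope * a]) dim].
Proof.
move=> [B [mB B0 sB]]; exists B; split=> // a Ba aD.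
have dimsa : (proj_angle theta @` D) a -> has_dims (slice D theta a) dim.
  by apply: contrapT => h; exact/Ba/sB.
have [z [Dz zh]] := slice_nonempty gasketD aD.
have aproj : (proj_angle theta @` D) a.
  exists z => //; move: zh; rewrite /= height_proj => /addrI/oppr_inj.
  by move/(mulfI (lt0r_neq0 slope_gt0)).
by have [+ _] := dimsa aproj; rewrite sliceE.
Qed.

End slice_counting.

(** * Lebesgue measure of the dyadic intervals *)

Section affine_cells.
Variables (R : realType) (m : nat) (r s : R).
Hypothesis s_gt0 : 0 < s.
Let Y (a : R) := r - s * a.

Lemma measurable_affine : measurable_fun setT (Y : measurableTypeR R -> measurableTypeR R).
Proof.
apply: measurable_funB; first exact: measurable_cst.
by apply: measurable_funM; [exact: measurable_cst|exact: measurable_id].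
Qed.

Lemma lebesgue_affine_itv (u v : R) : u < v ->
  lebesgue_measure [set a | u <= Y a < v] = (s^-1 * (v - u))%:E.
Proof.
(* [Y] is decreasing, so the half-open interval changes its closed end. *)
move=> uv; have -> : [set a | u <= Y a < v] = `](r - v) / s, (r - u) / s]%classic.
  apply/seteqP; split=> a /=; rewrite in_itv /= ltr_pdivrMr // ler_pdivlMr // /Y.
    by move=> /andP[h1 h2]; apply/andP; split; lra.
  by move=> /andP[h1 h2]; apply/andP; split; lra.
rewrite lebesgue_measure_itv /= lte_fin ltr_pM2r ?invr_gt0 //.
rewrite ltrD2l ltrN2 uv -EFinB; congr EFin.
by field; exact: lt0r_neq0.
Qed.

Lemma lebesgue_dyadic_cell n M :
  lebesgue_measure (dyadic_cell Y n M) = (s^-1 * 2 ^- n)%:E.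
Proof.
have n0 : 0 < 2 ^+ n :> R by rewrite exprn_gt0.
have -> : dyadic_cell Y n M = [set a | M%:~R / 2 ^+ n <= Y a < (M + 1)%:~R / 2 ^+ n].
  apply/seteqP; split=> a /=; rewrite /dyadic_cell /= ler_pdivrMr // ltr_pdivlMr //.
    by move/eqP; rewrite floor_eq.
  by move=> h; apply/eqP; rewrite floor_eq.
rewrite lebesgue_affine_itv ?ltr_pM2r ?invr_gt0 ?ltr_int ?ltzD1 //.
by rewrite -mulrBl intrD addrAC subrr add0r mul1r.
Qed.

End affine_cells.

Theorem proposition1p7 (R : realType) (p q : nat) (theta : R)
    (D : set (R * R))
    (nu : probability (measurableTypeR R * measurableTypeR R)%type R)
    (alpha beta : R) :
  (0 < p)%N -> (0 < q)%N -> gcdn p q = 1%N ->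
  0 < theta < pi / 3 ->
  tan theta = Num.sqrt 3 * p%:R / (2 * q%:R + p%:R) ->
  is_gasket D ->
  is_gasket_measure nu ->
  ae_slice_dim lebesgue_measure D theta alpha ->
  ae_slice_dim (pushforward nu (proj_angle theta)) D theta beta ->
  (cvgn (alpha_seq R p q) /\
   alpha = (ln 2)^-1 * limn (alpha_seq R p q)) /\
  (exists pv : 'cV[R]_(p + q),
    [/\ unique (@is_pvec R p q) pv,
        cvgn (beta_seq pv) &
        beta = (ln 2)^-1 * limn (beta_seq pv)]).
Proof.
move=> p_gt0 q_gt0 _ _ tanE gasketD gasket_nu aeL aeN.
have ln2 : ln 2 != 0 :> R by rewrite gt_eqF // ln_gt0 // ltr1n.
have s_gt0 := slope_gt0 R p q_gt0.
have conclude (u : nat -> R) (d : R) : u n @[n --> \oo] --> d * ln 2 ->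
    cvgn u /\ d = (ln 2)^-1 * limn u.
  move=> cu; split; first by apply/cvg_ex; exists (d * ln 2).
  by rewrite (cvg_lim (@Rhausdorff R) cu) mulrC mulfK.
split.
  refine (conclude _ _ (alpha_seq_cvg q_gt0 _)).
  have [B [mB B0 Bdim]] := ae_slice_box_dim q_gt0 gasketD tanE aeL.
  have muD : (lebesgue_measure
      (cell_domain (fun a => q%:R - slope R p q * a)%R (p + q)) < +oo)%E.
    by rewrite lebesgue_affine_itv ?ltry // ltr0n addn_gt0 p_gt0.
  have := crossing_L1 p_gt0 q_gt0 gasketD
    (measurable_affine q%:R (slope R p q)) muD mB B0 Bdim.
  set S := (X in X @ _ --> _) => L1.
  (* Cells have Lebesgue mass [2 ^- n / slope]; multiplying by [slope] yields the weights
     [2 ^- n]. *)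
  have sS : slope R p q * S n @[n --> \oo] --> slope R p q * 0.
    by apply: cvgM => //; exact: cvg_cst.
  rewrite mulr0 in sS; apply: cvg_trans sS; apply: near_eq_cvg; near=> n.
  rewrite /S mulr_sumr; apply: eq_bigr => M _.
  have /= cE := congr1 fine (lebesgue_dyadic_cell q%:R s_gt0 n M%:Z).
  rewrite [X in _ * (_ * X) = _]cE.
  by field; rewrite ?lt0r_neq0 // exprn_gt0.
exists (pvec p q nu).
have pvP := is_pvec_pvec p_gt0 q_gt0 gasket_nu.
have [cvg_beta betaE] : cvgn (beta_seq (pvec p q nu)) /\
    beta = (ln 2)^-1 * limn (beta_seq (pvec p q nu)); last first.
  by split=> //; split=> // w; exact: pvec_unique.
apply: conclude.
apply: (beta_seq_cvg q_gt0 (W := fun n M => nu_cell p q nu n M%:Z)).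
- by case: pvP.
- by move=> n w i; exact: nu_cell_weight.
- by move=> n; exact: sum_nu_cell.
have [B [mB B0 Bdim]] := ae_slice_box_dim q_gt0 gasketD tanE aeN.
have mproj : measurable_fun setT
    (proj_angle theta : (measurableTypeR R * measurableTypeR R)%type -> measurableTypeR R).
  apply: measurable_funB; first exact: measurable_snd.
  by apply: measurable_funM; [exact: measurable_fst|exact: measurable_cst].
(* A null set of the pushforward is one whose preimage under the projection is [nu]-null; this
   preimage is the exceptional set in the plane. *)
have mB' := mproj measurableT B mB; rewrite setTI in mB'.
have nuD : (nu (cell_domain (height p q) (p + q)) < +oo)%E.
  by rewrite gasket_measure_domain // ltry.
apply: (crossing_L1 p_gt0 q_gt0 gasketD (measurable_height p q) nuD mB' B0).
move=> z Bz; rewrite (height_proj q_gt0 tanE); exact: Bdim.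
Unshelve. all: by end_near. Qed.
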